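(* Let $A$ be a finite alphabet of cardinality $N$, $X=A^{\mathbb{Z}_+}$, $n,k$ positive integers, $K=A^{[n]}$, $K^*=A^{[n+k]}$, and let $g$ be the shift-like map on $X$ associated with a map $\gamma:K^*\to K$. Let $\lambda_0=\sum_{s\in K}N^{-n}\lambda_s$, which is the $\frac1N$ Bernoulli measure on $X$, be the background measure. For each terminal $G$ basic set $B$ with associated $G^*$ basic set $B^*$, the measure $\lambda_B=\sum_{s\in B}v_B(s)\lambda_s$ is an ergodic $g$-invariant measure with support $H_\gamma(B^*_{G^*})$. With the measures $\{\lambda_B\}$ indexed by the terminal $G$ basic sets, the system $(X,g)$ is tractable.
   Context: $A^{[m]}$ is the set of words of length $m$; $J_m$ gives initial words of length $m$ (of sequences or longer words); $X=A^{\mathbb{Z}_+}$ has metric $d(x,y)=\inf\{1/(k+1):x_i=y_i\ \forall i<k\}$. The shift-like map is $g(s^*x)=\gamma(s^* )x$ for $s^*\in K^*$, $x\in X$. $J=J_n:K^*\to K$; $\bar J(s^* )$ is the terminal word of length $k$ of $s^*$. Relations: $(s,t)\in G$ iff $t=\gamma(s^* )$ for some $s^*$ with $J(s^* )=s$; $(s_1^*,s_2^* )\in G^*$ iff $J(s_2^* )=\gamma(s_1^* )$. For a relation $F$ on a finite set, $\mathcal{O}F=\bigcup_{n\ge1}F^n$, basic sets are classes of $\{s:(s,s)\in\mathcal{O}F\}$ under mutual $\mathcal{O}F$-reachability, terminal means $\mathcal{O}F(B)\subset B$; the $G^*$ basic set associated with a $G$ basic set $B$ is $B^*=\gamma^{-1}(B)\cap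 J^{-1}(B)$. $K^*_{G^*}$ is the space of sequences $\mathbf{s}^*$ in $K^*$ with consecutive pairs in $G^*$, $B^*_{G^*}=K^*_{G^*}\cap(B^* )^{\mathbb{Z}_+}$, and $H_\gamma(\mathbf{s}^* )=s^*_0\bar J(s^*_1)\bar J(s^*_2)\cdots$. For $s\in K$, $\lambda_s$ is the probability measure supported on the cylinder $\langle s\rangle=\{x:J_n(x)=s\}$ with $\lambda_s(\langle s\bar s_0\cdots\bar s_{p-1}\rangle)=N^{-pk}$ for $\bar s_j\in A^{[k]}$. $\Gamma$ is the stochastic matrix on $K$ with $\Gamma_{s_2s_1}=N^{-k}\,\#\{s^*:J(s^* )=s_1,\gamma(s^* )=s_2\}$, and for terminal $B$, $v_B$ is the unique distribution with $\Gamma v_B=v_B$ and support exactly $B$. Tractability of $(X,g)$ with respect to a full background measure $\lambda_0$: TRAC 1: $g$ has finitely many basic sets (chain components); TRAC 2: there are finitely many ergodic invariant probability measures $\mu_1,\dots,\mu_k$ such that every point outside a $\lambda_0$-null set is generic for some $\mu_i$ (generic: $\frac1n\sum_{i<n}u(g^ix)\to\int u\,d\mu_i$ for all continuous $u$); TRAC 3: each support $|\mu_i|$ is contained in a visible basic set (one with nonempty basin $\operatorname{int}\{x:\omega g(x)\subset B\}$); TRAC 4: for $i\ne j$, $\lambda_0(|\mu_i|\cap|\mu_j|)=0$. *)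

(* Defs.v *)
From HB Require Import structures.
From mathcomp Require Import all_boot all_order all_algebra.
From mathcomp Require Import all_classical all_reals all_analysis.

Set Implicit Arguments.
Unset Strict Implicit.
Unset Printing Implicit Defensive.
Import Order.TTheory GRing.Theory Num.Theory.

Local Open Scope classical_set_scope.
Local Open Scope ring_scope.

Notation word A m := {ffun 'I_m -> A}.

(* The sequence space X = A^{Z_+}.  The parameter a0 (a letter of A) only
   serves to make X a pointed type (A is nonempty); nothing depends on it. *)
Definition seqsp (A : finType) (a0 : A) : Type := nat -> A.
HB.instance Definition _ (A : finType) (a0 : A) := Choice.on (@seqsp A a0).
HB.instance Definition _ (A : finType) (a0 : A) :=
  isPointed.Build (@seqsp A a0) (fun _ => a0).

Section Defs.
Variables (A : finType) (a0 : A).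
Local Notation X := (@seqsp A a0).

(* letter j of a word w (a0 if out of range; never used out of range) *)
Definition wat m (w : word A m) (j : nat) : A :=
  oapp w a0 (insub j : option 'I_m).

(* x and y agree on the first k coordinates, i.e. d(x,y) <= 1/(k+1)
   for the metric d(x,y) = inf{1/(k+1) : x_i = y_i for all i < k}. *)
Definition agree (x y : X) (k : nat) : Prop := forall i, (i < k)%N -> x i = y i.

Definition opn (U : set X) : Prop :=
  forall x, U x -> exists k, forall y, agree x y k -> U y.

Definition interior_d (S : set X) : set X :=
  [set x | exists k, forall y, agree x y k -> S y].

Definition dcontinuous {R : realType} (u : X -> R) : Prop :=
  forall x (e : R), 0 < e -> exists k, forall y, agree x y k -> `|u x - u y| < e.

Definition Xm := g_sigma_algebraType opn.

Definition cyl m (w : word A m) : set X := [set x : X | forall i : 'I_m, x i = w i].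

(* cylinder <s sbar_0 ... sbar_{p-1}> with s in A^[n], sbar_j in A^[k] *)
Definition cyl_ext n k (s : word A n) p (sb : 'I_p -> word A k) : set X :=
  [set x : X | (forall i : 'I_n, x i = s i) /\
           (forall (j : 'I_p) (l : 'I_k), x (n + j * k + l)%N = sb j l)].

Definition prefix m (x : X) : word A m := [ffun i : 'I_m => x i].

Variables (n k : nat).

Definition Jn (s : word A (n + k)) : word A n := [ffun i : 'I_n => s (lshift k i)].
Definition Jbar (s : word A (n + k)) : word A k := [ffun i : 'I_k => s (rshift n i)].

Variable gam : word A (n + k) -> word A n.

(* the shift-like map: g(s x) = gamma(s) x for s in Kstar = A^[n+k] *)
Definition gmap (x : X) : X :=
  fun i => if (i < n)%N then wat (gam (prefix (n + k) x)) i else x (i + k)%N.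

Definition Grel : rel (word A n) :=
  fun s t => [exists s' : word A (n + k), (Jn s' == s) && (gam s' == t)].
Definition Gstar : rel (word A (n + k)) := fun s1 s2 => Jn s2 == gam s1.

Definition Bstar (B : {set word A n}) : {set word A (n + k)} :=
  finset (fun s' => (gam s' \in B) && (Jn s' \in B)).

Definition BstarG (B : {set word A n}) : set (nat -> word A (n + k)) :=
  [set ss | (forall i, Gstar (ss i) (ss i.+1)) /\ (forall i, ss i \in Bstar B)].

(* H_gamma(ss) = ss_0 Jbar(ss_1) Jbar(ss_2) ... *)
Definition Hgam (ss : nat -> word A (n + k)) : X :=
  fun i => if (i < n + k)%N then wat (ss 0%N) i
           else wat (Jbar (ss ((i - n) %/ k)%N)) ((i - n) %% k)%N.

Definition Gam {R : realType} (s2 s1 : word A n) : R :=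
  (#|A|%:R ^- k) * #|finset (fun s' : word A (n + k) => (Jn s' == s1) && (gam s' == s2))|%:R.

End Defs.

Section FinRel.
Variables (T : finType) (F : rel T).

Definition OF : rel T := fun s t => [exists u, F s u && connect F u t].

Definition fbasic (B : {set T}) : Prop :=
  exists s, OF s s /\ B = finset (fun t => [&& OF t t, OF s t & OF t s]).

Definition fterminal (B : {set T}) : Prop :=
  forall s t, s \in B -> OF s t -> t \in B.

Definition stat_dist {R : realType} (Gm : T -> T -> R) (B : {set T}) (v : T -> R) : Prop :=
  [/\ forall s, 0 <= v s, \sum_s v s = 1,
      forall s2, \sum_s1 Gm s2 s1 * v s1 = v s2 &
      forall s, (0 < v s) = (s \in B)].
End FinRel.

Section Dyn.
Variables (A : finType) (a0 : A).
Local Notation X := (@seqsp A a0).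
Variable g : X -> X.

Definition chain (kk : nat) (x y : X) : Prop :=
  exists (m : nat) (xs : nat -> X), [/\ (0 < m)%N, xs 0%N = x, xs m = y &
     forall i, (i < m)%N -> agree (g (xs i)) (xs i.+1) kk].

Definition Cg (x y : X) : Prop := forall kk, chain kk x y.

Definition gbasic (C : set X) : Prop :=
  exists x, Cg x x /\ C = [set y | Cg y y /\ Cg x y /\ Cg y x].

Definition omega (x : X) : set X :=
  [set y | forall kk m, exists j, (m <= j)%N /\ agree (iter j g x) y kk].

Definition basin (C : set X) : set X := interior_d [set x | omega x `<=` C].

Definition visible (C : set X) : Prop := basin C !=set0.

Variable R : realType.

Definition msupport (mu : {measure set (Xm a0) -> \bar R}) : set X :=
  [set x | forall U, opn U -> U x -> (0 < mu U)%E].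

Definition g_invariant (mu : {measure set (Xm a0) -> \bar R}) : Prop :=
  forall S : set (Xm a0), measurable S -> mu (g @^-1` S) = mu S.

Definition g_ergodic (mu : {measure set (Xm a0) -> \bar R}) : Prop :=
  forall S : set (Xm a0), measurable S -> g @^-1` S = S ->
    mu S = 0%E \/ mu S = 1%E.

Definition generic (mu : {measure set (Xm a0) -> \bar R}) (x : X) : Prop :=
  forall u : X -> R, dcontinuous u ->
    (fun m : nat => ((m%:R)^-1 * \sum_(i < m) u (iter i g x))%:E) @ \oo
      --> (\int[mu]_y (u y)%:E)%E.
End Dyn.

Arguments cyl {A} a0 {m} w _.
Arguments cyl_ext {A} a0 {n k} s {p} sb _.
Arguments gmap {A} a0 {n k} gam x _.

(* Main.v *)
(* Splitting a sequence as a word of length n followed by blocks of length k, the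
   words J(g^q x) read along an orbit form a path in G whose successive steps are
   governed by independent uniform blocks.  Chains and chain components of g are
   thereby read off G: changing the tail of x beyond n + q k letters is a small
   perturbation which lets one follow any path of G.  On the measure side, everything
   rests on the Markov property: conditionally on the first n + q k letters of x, the
   point g^q x has law lambda_s with s = J(g^q x).  It gives
   lambda_s(g^-1 S) = sum_t Gamma_ts lambda_t(S), hence invariance of lambda_B; an
   invariant set S makes s |-> lambda_s(S) harmonic, so constant on B by the maximum
   principle, so S is independent of all cylinders and thus of itself; and the
   probability of never entering a terminal class is subharmonic, hence zero.
   Genericity of almost every point then follows from the ergodic theorem for
   cylinder functions, since continuous functions are uniform limits of these. *)
Require Import Defs.
From HB Require Import structures.
From mathcomp Require Import all_boot all_order all_algebra.
From mathcomp Require Import all_classical all_reals all_analysis.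
From mathcomp Require Import measurable_realfun zify ring lra.
Import Order.TTheory GRing.Theory Num.Theory.
Local Open Scope classical_set_scope.
Local Open Scope ring_scope.

Set Implicit Arguments.
Unset Strict Implicit.
Unset Printing Implicit Defensive.

(** * Reachability in a finite relation *)

Section FiniteRelation.
Context {T : finType} (F : rel T).

Lemma OF_connect s t : OF F s t -> connect F s t.
Proof. by case/existsP=> u /andP[/connect1 su]; exact: connect_trans. Qed.

(** [OF] needs at least one edge while [connect] allows none: the first edge comes from the path, or
    from [OF F t u] when the path is empty. *)
Lemma connect_OF s t u : connect F s t -> OF F t u -> OF F s u.
Proof.
move=> + /existsP[w /andP[tw wu]].
case/connectP=> -[|x p] /=.
  by move=> _ <-; apply/existsP; exists w; rewrite tw.
case/andP=> sx /path_connect xt tE; apply/existsP; exists x; rewrite sx /=.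
apply: connect_trans (xt t _) _; first by rewrite tE mem_last.
exact: connect_trans (connect1 tw) wu.
Qed.

Lemma OF_trans s t u : OF F s t -> OF F t u -> OF F s u.
Proof. by move=> /OF_connect; exact: connect_OF. Qed.

Lemma OF1 s t : F s t -> OF F s t.
Proof. by move=> st; apply/existsP; exists t; rewrite st connect0. Qed.

Context {B : {set T}}.
Hypothesis fB : fbasic F B.

Lemma fbasic_neq0 : exists s, s \in B.
Proof. by have [s [ss ->]] := fB; exists s; rewrite finset.inE ss. Qed.

Lemma fbasic_OF s t : s \in B -> t \in B -> OF F s t.
Proof.
have [s0 [s00 ->]] := fB; rewrite !finset.inE => /and3P[_ _ s0s] /and3P[_ ? _].
exact: OF_trans s0s _.
Qed.

Lemma fbasicE s : s \in B ->
  B = finset (fun t => [&& OF F t t, OF F s t & OF F t s]).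
Proof.
move=> sB; apply/setP => t; rewrite finset.inE; apply/idP/and3P => [tB|[tt st ts]].
  by split; apply: fbasic_OF.
have [s0 [s00 BE]] := fB; move: sB; rewrite BE !finset.inE tt.
by move=> /and3P[_ s0s ss0]; rewrite (OF_trans s0s st) (OF_trans ts ss0).
Qed.

Hypothesis tB : fterminal F B.

Lemma fterminal_connect s t : s \in B -> connect F s t -> t \in B.
Proof.
move=> sB /connectP[[|x p] /=] => [_ -> //|/andP[sx xp] ->].
apply: (tB sB); apply/existsP; exists x; rewrite sx /=.
by apply/connectP; exists p.
Qed.
End FiniteRelation.

Lemma fbasic_eq {T : finType} {F : rel T} {B B' : {set T}} s :
  fbasic F B -> fbasic F B' -> s \in B -> s \in B' -> B = B'.
Proof. by move=> fB fB' sB sB'; rewrite (fbasicE fB sB) (fbasicE fB' sB'). Qed.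

(* A state from which the fewest states can be reached lies in a terminal class. *)
Lemma reach_fterminal {T : finType} {F : rel T} s :
  (forall s, exists t, F s t) ->
  exists B t, [/\ fbasic F B, fterminal F B, connect F s t & t \in B].
Proof.
move=> Ftot; pose r t := #|finset (connect F t)|.
have [t st tmin] := @arg_minnP _ s (connect F s) r (connect0 _ _).
have back u : connect F t u -> connect F u t.
  move=> tu; have su := connect_trans st tu.
  have sub : finset (connect F u) \subset finset (connect F t).
    by apply/fintype.subsetP => w; rewrite !finset.inE; exact: connect_trans.
  have /setP/(_ t) : finset (connect F u) = finset (connect F t).
    by apply/eqP; rewrite eqEcard sub tmin.
  by rewrite !finset.inE connect0.
(* Totality of [F] supplies the edge that [OF] requires. *)
have loop u : connect F t u -> OF F u u.
  move=> tu; have [w uw] := Ftot u; apply/existsP; exists w; rewrite uw /=.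
  by apply: connect_trans (back w (connect_trans tu (connect1 uw))) tu.
have tt := loop t (connect0 _ _).
exists (finset (fun u => [&& OF F u u, OF F t u & OF F u t])), t.
split=> //; last by rewrite finset.inE tt.
  by exists t.
move=> u w; rewrite !finset.inE => /and3P[uu tu ut] uw.
have tw := OF_trans tu uw.
have ww := loop w (OF_connect tw).
by rewrite ww tw (connect_OF (back w (OF_connect tw)) tt).
Qed.

(** * Orbits and chains of the shift-like map *)

Section ShiftLike.
Context {A : finType} {a0 : A} {n k : nat} (gam : word A (n + k) -> word A n).
Hypothesis (hn : (0 < n)%N) (hk : (0 < k)%N).
Local Notation X := (@seqsp A a0).
Local Notation g := (gmap a0 gam).
Local Notation prefix := (@Defs.prefix A a0).
Local Notation J := (@Defs.prefix A a0 n).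
Implicit Types x y z : X.

Definition wext {m} (w : word A m) : X := fun i => wat a0 w i.

Lemma watE m (w : word A m) (i : 'I_m) : wat a0 w i = w i.
Proof. by rewrite /wat valK. Qed.

Lemma prefix_wext m (w : word A m) : prefix m (wext w) = w.
Proof. by apply/ffunP => i; rewrite ffunE /wext watE. Qed.

Lemma agreeP m x y : agree x y m <-> prefix m x = prefix m y.
Proof.
split=> [xy|/ffunP xy i im]; first by apply/ffunP => i; rewrite !ffunE xy.
by have := xy (Ordinal im); rewrite !ffunE.
Qed.

Lemma agree_refl m x : agree x x m. Proof. by []. Qed.

Lemma agree_sym m x y : agree x y m -> agree y x m.
Proof. by move=> xy i /xy. Qed.

Lemma agree_trans m y x z : agree x y m -> agree y z m -> agree x z m.
Proof. by move=> xy yz i im; rewrite xy // yz. Qed.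

Lemma agree_le m m' x y : (m <= m')%N -> agree x y m' -> agree x y m.
Proof. by move=> mm' xy i im; apply: xy; exact: leq_trans mm'. Qed.

Lemma wext_prefix m x : agree (wext (prefix m x)) x m.
Proof. by apply/agreeP; rewrite prefix_wext. Qed.

Lemma cylE m (w : word A m) : cyl a0 w = [set y | prefix m y = w].
Proof.
apply/seteqP; split=> y /= yw; first by apply/ffunP => i; rewrite ffunE yw.
by move=> i; rewrite -yw ffunE.
Qed.

Lemma J_g x : J (g x) = gam (prefix (n + k) x).
Proof. by apply/ffunP => i; rewrite ffunE /gmap ltn_ord watE. Qed.

Lemma iter_g_tail q x i : (n <= i)%N -> iter q g x i = x (i + q * k)%N.
Proof.
elim: q i => [|q IH] i ni; first by rewrite addn0.
rewrite iterS {1}/gmap ltnNge ni /= IH ?mulSn ?addnA //.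
exact: leq_trans (leq_addr _ _).
Qed.

Lemma agree_g L x y : (n <= L)%N -> agree x y (L + k) -> agree (g x) (g y) L.
Proof.
move=> nL xy i iL; rewrite /gmap; case: ltnP => [_|ni]; last by apply: xy; lia.
suff -> : prefix (n + k) x = prefix (n + k) y by [].
by apply/agreeP; apply: agree_le xy; lia.
Qed.

Lemma agree_iter_g q L x y : (n <= L)%N -> agree x y (L + q * k) ->
  agree (iter q g x) (iter q g y) L.
Proof.
move=> nL; elim: q L nL => [|q IH] L nL; first by rewrite addn0.
by move=> xy; rewrite !iterS; apply: agree_g => //; apply: IH; [|apply: agree_le xy]; lia.
Qed.

(** The tail of [y] is taken from its letter [n] on: its first [n] letters are meant to be
    [J (g^q x)], which the head of [x] already determines. *)
Definition splice q x y : X := fun i => if (i < n + q * k)%N then x i else y (i - q * k)%N.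

Lemma agree_splice q x y : agree x (splice q x y) (n + q * k).
Proof. by move=> i iq; rewrite /splice iq. Qed.

(** The first [n] letters of the image under [g^q] depend only on the [n + q k] letters kept from
    [x], and beyond them [g^q] is the shift by [q k]. *)
Lemma iter_splice q x y : J (iter q g x) = J y -> iter q g (splice q x y) = y.
Proof.
move/agreeP => xy; apply/funext => i; case: (ltnP i n) => ni.
  rewrite -xy //; apply/esym; apply: agree_iter_g (leqnn n) _ _ ni.
  exact: agree_splice.
by rewrite iter_g_tail // /splice ltn_add2r ltnNge ni /= addnK.
Qed.

(** A cylinder cut by the [q]-th preimage of another one is again a cylinder, or empty; the Markov
    property rests on this. *)
Lemma spliceP q L x y z : (n <= L)%N ->
  agree x z (n + q * k) /\ agree y (iter q g z) L <->
  J (iter q g x) = J y /\ agree (splice q x y) z (L + q * k).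
Proof.
move=> nL; split=> [[xz yz]|[xy sz]].
  have xy : J (iter q g x) = J y.
    apply/agreeP; apply: agree_trans (agree_sym (agree_le nL yz)).
    exact: agree_iter_g.
  split=> // i iL; rewrite /splice; case: ltnP => iq; first exact: xz.
  by rewrite yz ?iter_g_tail ?subnK //; lia.
split.
  by apply: agree_trans (@agree_splice _ _ _) (agree_le _ sz); lia.
by rewrite -(iter_splice xy); apply: agree_iter_g.
Qed.

Local Notation G := (Grel gam).

Lemma Grel_g x : G (J x) (J (g x)).
Proof.
apply/existsP; exists (prefix (n + k) x); rewrite J_g eqxx andbT.
by apply/eqP/ffunP => i; rewrite !ffunE.
Qed.

Lemma connect_iter_g q x : connect G (J x) (J (iter q g x)).
Proof.
elim: q => [|q IH]; first exact: connect0.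
by rewrite iterS; apply: connect_trans IH _; exact/connect1/Grel_g.
Qed.

Lemma Jn_prefix x : Jn (prefix (n + k) x) = J x.
Proof. by apply/ffunP => i; rewrite !ffunE. Qed.

Lemma Grel_lift s t y : G s t -> J y = t -> exists z, J z = s /\ g z = y.
Proof.
case/existsP => w /andP[/eqP ws /eqP wt] yt; exists (splice 1 (wext w) y).
split; last by apply: (@iter_splice 1); rewrite /= J_g prefix_wext wt yt.
rewrite -ws -{2}(prefix_wext w) Jn_prefix; apply/agreeP/agree_sym.
by apply: agree_le (@agree_splice 1 _ _); lia.
Qed.

Lemma connect_lift s y : connect G s (J y) -> exists z r, J z = s /\ iter r g z = y.
Proof.
case/connectP => p; elim: p s => [|t p IH] s /= => [_ sy|/andP[st tp] yE].
  by exists y, 0%N.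
have [z [r [zt zy]]] := IH t tp yE.
have [z' [z's z'z]] := Grel_lift st zt.
by exists z', r.+1; rewrite iterSr z'z.
Qed.

Lemma Grel_total s : exists t, G s t.
Proof. by exists (J (g (wext s))); rewrite -{1}(prefix_wext s) Grel_g. Qed.

(** The only error of the chain is a jump from [g x] to [g z'], where [z'] copies a long initial
    word of [x]; afterwards the true orbit of [z'] leads to [y]. Every [q] is assumed because the
    path of [G] is entered at time [m.+1], which grows with the precision. *)
Lemma Cg_of_connect x y :
  (forall q, connect G (J (iter q g x)) (J y)) -> Cg g x y.
Proof.
move=> xy m; have [z [r [zx zy]]] := connect_lift (xy m.+1).
pose z' := splice m.+1 x z.
(* [m.+1] iterates bring [z'] to [z] and [r] more bring [z] to [y]; index [0] holds [x] in place of
   [z']. *)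
exists (r + m.+1)%N, (fun i => if i is 0 then x else iter i g z'); split=> //.
- by rewrite addnS.
- by rewrite addnS -addnS iterD iter_splice.
case=> [|i] _ /=; last exact: agree_refl.
apply: (@agree_le _ (n + m)); first by lia.
apply: agree_g; first by lia.
apply: agree_le (@agree_splice _ _ _); nia.
Qed.

(** A closed chain is run [q] times; at each wrap-around its last point [xs p] and its first point
    are both [x]. *)
Lemma chain_loop m q x : chain g m x x ->
  exists p xs, [/\ (q <= p)%N, xs 0%N = x, xs p = x &
    forall i, (i < p)%N -> agree (g (xs i)) (xs i.+1) m].
Proof.
move=> [p [xs [p0 xs0 xsp xsP]]]; exists (q * p)%N, (fun i => xs (i %% p)%N).
split; rewrite ?mod0n ?modnMl //; first by rewrite leq_pmulr.
move=> i _; have := xsP _ (ltn_pmod i p0); rewrite modnS.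
case: ifP => // /eqP; rewrite modnS; case: ifP => [pi|] // _.
suff -> : (i %% p).+1 = p by rewrite xsp -xs0.
have := ltn_pmod i p0; rewrite leq_eqVlt => /predU1P[//|ip].
by move: pi; rewrite /dvdn -addn1 -modnDml addn1 modn_small.
Qed.

(** Along a closed chain of precision [n + q k], the orbit of [x] shadows the chain for [q] steps,
    losing [k] letters at each, so [J] still agrees at time [q]. The rest of the chain projects to a
    path of [G] ending at [J x]. *)
Lemma connect_of_Cg q x : Cg g x x -> connect G (J (iter q g x)) (J x).
Proof.
move=> /(_ (n + q * k)%N) /(chain_loop q) [p [xs [qp xs0 xsp xsP]]].
have xsE i : (i <= q)%N -> agree (iter i g x) (xs i) (n + (q - i) * k).
  elim: i => [|i IH] iq; first by rewrite subn0 xs0.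
  apply: agree_trans (agree_le _ (xsP i _)); [|nia|lia].
  rewrite iterS; apply: agree_g; first by nia.
  by apply: agree_le (IH (ltnW iq)); nia.
have -> : J (iter q g x) = J (xs q).
  by apply/agreeP; apply: agree_le (xsE q (leqnn q)); lia.
have xsC d : (q + d <= p)%N -> connect G (J (xs q)) (J (xs (q + d)%N)).
  elim: d => [|d IH] dp; first by rewrite addn0.
  rewrite addnS in dp *; apply: connect_trans (IH (ltnW dp)) _; apply: connect1.
  suff <- : J (g (xs (q + d)%N)) = J (xs (q + d).+1) by exact: Grel_g.
  by apply/agreeP; apply: agree_le (xsP _ dp); lia.
by have := xsC (p - q)%N; rewrite subnKC // xsp; exact.
Qed.

End ShiftLike.

(** * Chain components and basic sets of the shift-like map *)

Section BasicSets.
Context {A : finType} {a0 : A} {n k : nat} {gam : word A (n + k) -> word A n}.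
Hypothesis (hn : (0 < n)%N) (hk : (0 < k)%N).
Local Notation X := (@seqsp A a0).
Local Notation g := (gmap a0 gam).
Local Notation prefix := (@Defs.prefix A a0).
Local Notation J := (@Defs.prefix A a0 n).
Local Notation G := (Grel gam).
Implicit Types (x y z : X) (B : {set word A n}).

Lemma wat_prefix m x i : (i < m)%N -> wat a0 (prefix m x) i = x i.
Proof. exact: wext_prefix. Qed.

Lemma fterminal_J B q x : fterminal G B -> J x \in B -> J (iter q g x) \in B.
Proof. by move=> tB xB; apply: (fterminal_connect tB xB); exact: connect_iter_g. Qed.

(** The sequence of [(n + k)]-prefixes along the orbit of [x] is a preimage of [x], and terminality
    keeps it over [B]. Conversely, [J] of an image point is [Jn] of the first word. *)
Lemma Hgam_image B : fterminal G B ->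
  Hgam a0 (n := n) (k := k) @` BstarG gam B = [set x | J x \in B].
Proof.
move=> tB; apply/seteqP; split=> [_ [ss [_ /(_ 0%N) + <-]]|x xB] /=.
  rewrite finset.inE => /andP[_]; set s := Jn _; suff -> : s = J (Hgam a0 ss) by [].
  apply/ffunP => i; rewrite !ffunE /Hgam ifT; last by rewrite ltn_addr.
  by rewrite -(watE (a0 := a0)).
have sE i : Jn (prefix (n + k) (iter i g x)) = J (iter i g x) by exact: Jn_prefix.
have gE i : gam (prefix (n + k) (iter i g x)) = J (iter i.+1 g x).
  by rewrite iterS J_g.
exists (fun i => prefix (n + k) (iter i g x)); first split=> i.
- by rewrite /Gstar sE gE.
- by rewrite finset.inE sE gE !fterminal_J.
apply/funext => i; rewrite /Hgam; case: ltnP => ink; first by rewrite wat_prefix.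
have rk : ((i - n) %% k < k)%N by rewrite ltn_mod.
rewrite -[X in wat _ _ X]/(nat_of_ord (Ordinal rk)) watE !ffunE /=.
rewrite iter_g_tail ?leq_addr // -addnA [X in (n + X)%N]addnC -divn_eq subnKC //; lia.
Qed.

Lemma chain_connect m x y : (n <= m)%N -> chain g m x y -> connect G (J x) (J y).
Proof.
move=> nm [p [xs [_ <- <- xsP]]]; elim: p xsP => [|p IH] xsP; first exact: connect0.
apply: connect_trans (IH _) _ => [i ip|]; first by apply: xsP; exact: ltnW.
apply: connect1; suff <- : J (g (xs p)) = J (xs p.+1) by exact: Grel_g.
by apply/agreeP; apply: agree_le nm (xsP p _).
Qed.

(* Chain components are thus determined by a word of length [n]. *)
Lemma Cg_connect x y : Cg g x x -> Cg g x y <-> connect G (J x) (J y).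
Proof.
move=> xx; split=> [/(_ n) /chain_connect|xy]; first exact.
by apply: Cg_of_connect => // q; apply: connect_trans xy; exact: connect_of_Cg.
Qed.

Lemma finite_gbasic : finite_set [set C | gbasic g C].
Proof.
pose F s := [set y | Cg g y y /\ connect G s (J y) /\ connect G (J y) s].
apply: (@sub_finite_set _ _ (F @` setT)); last exact/finite_image/finite_finset.
move=> C [x [xx ->]]; exists (J x) => //; apply/seteqP; split=> y [yy].
  by move=> [/(Cg_connect _ xx) ? /(Cg_connect _ yy)].
by move=> [/(Cg_connect _ xx) ? /(Cg_connect _ yy)].
Qed.

Lemma fbasic_Cg B x y : fbasic G B -> fterminal G B ->
  J x \in B -> J y \in B -> Cg g x y.
Proof.
move=> fB tB xB yB; apply: Cg_of_connect => // q; apply: OF_connect.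
by apply: (fbasic_OF fB) => //; exact: fterminal_J.
Qed.

Lemma fbasic_visible B : fbasic G B -> fterminal G B ->
  exists C, [/\ gbasic g C, visible g C & [set x | J x \in B] `<=` C].
Proof.
move=> fB tB; have [s sB] := fbasic_neq0 fB; pose x : X := wext s.
have xB : J x \in B by rewrite prefix_wext.
pose C := [set y | Cg g y y /\ Cg g x y /\ Cg g y x].
have subC : [set y | J y \in B] `<=` C.
  by move=> y yB; split; [|split]; exact: (fbasic_Cg fB tB).
exists C; split=> //; first by exists x; split=> //; exact: (fbasic_Cg fB tB).
(* Radius [n] suffices: a point that shares [J x] has its whole orbit over [B], and so are its limit
   points. *)
exists x; exists n => y xy z /(_ n 0%N)[j [_ yz]]; apply: subC => /=.
have /agreeP <- := yz; apply: fterminal_J => //.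
by have /agreeP <- := xy.
Qed.

End BasicSets.

(** * The Markov property *)

Section MarkovMeasures.
Context {R : realType} {A : finType} {a0 : A} {n k : nat}.
Context {gam : word A (n + k) -> word A n}.
Hypothesis (hn : (0 < n)%N) (hk : (0 < k)%N).
Local Notation X := (@seqsp A a0).
Local Notation Xmeas := (Xm a0).
Local Notation g := (gmap a0 gam).
Local Notation prefix := (@Defs.prefix A a0).
Local Notation J := (@Defs.prefix A a0 n).
Local Notation G := (Grel gam).
Implicit Types (x y z : X) (B : {set word A n}).

Definition cylat L x : set Xmeas := [set y | agree x y L].

Lemma opn_measurable (U : set X) : opn U -> measurable (U : set Xmeas).
Proof. exact: sub_sigma_algebra. Qed.

Lemma cylinder_opn L (S : set X) : (forall x y, agree x y L -> S x -> S y) -> opn S.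
Proof. by move=> SL x Sx; exists L => y /SL; exact. Qed.

Lemma cylinder_measurable L (S : set X) :
  (forall x y, agree x y L -> S x -> S y) -> measurable (S : set Xmeas).
Proof. by move=> SL; apply: opn_measurable; exact: cylinder_opn SL. Qed.

Lemma measurable_cylat L x : measurable (cylat L x).
Proof.
by apply: (@cylinder_measurable L) => y z yz xy; exact: agree_trans xy yz.
Qed.

Lemma opn_setI : setI_closed (@opn A a0).
Proof.
move=> U V oU oV x [/oU[p Up] /oV[q Vq]]; exists (maxn p q) => y xy.
by split; [apply: Up|apply: Vq]; apply: agree_le xy; rewrite ?leq_maxl ?leq_maxr.
Qed.

Lemma measurable_g : measurable_fun setT (g : Xmeas -> Xmeas).
Proof.
apply: (@measurability _ _ Xmeas Xmeas setT g (@opn A a0)) => // _ [U oU <-].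
rewrite setTI; apply: opn_measurable => x /oU[p Up]; exists (maxn n p + k)%N => y xy.
apply: Up; apply: (agree_le (leq_maxr n p)).
by apply: agree_g => //; exact: leq_maxl.
Qed.

Lemma measurable_iter_g q : measurable_fun setT (iter q g : Xmeas -> Xmeas).
Proof.
by elim: q => [|q IH]; [exact: measurable_id|exact: measurableT_comp measurable_g IH].
Qed.

Lemma measure_fibers (T : finType) (f : X -> T) (mu : {measure set Xmeas -> \bar R})
    (S : set Xmeas) : (forall t, measurable (f @^-1` [set t] : set Xmeas)) -> measurable S ->
  mu S = (\sum_t mu (f @^-1` [set t] `&` S))%E.
Proof.
move=> mf mS; rewrite (@bigfs _ _ _ _ _ predT); [|exact: index_enum_uniq|]; last first.
  by move=> i _; rewrite mem_index_enum.
rewrite (_ : [set` predT] = setT); last by apply/seteqP; split.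
rewrite -measure_fin_bigcup //; last first.
- by move=> t _; exact: measurableI.
- by move=> t t' _ _ [y [[<- _] [<- _]]].
- exact: finite_finset.
congr (mu _); apply/seteqP; split=> [y Sy|y [w _ []]//].
by exists (f y).
Qed.

Lemma cylatE L (w : word A L) : cylat L (wext w) = prefix L @^-1` [set w].
Proof.
apply/seteqP; split=> y; rewrite /cylat /=; first by move/agreeP <-; rewrite prefix_wext.
by move=> <-; exact: wext_prefix.
Qed.

Lemma measure_partition L (mu : {measure set Xmeas -> \bar R}) (S : set Xmeas) :
  measurable S -> mu S = (\sum_(w : word A L) mu (cylat L (wext w) `&` S))%E.
Proof.
move=> mS; rewrite (@measure_fibers _ (prefix L)) //.
  by apply: eq_bigr => w _; rewrite cylatE.
by move=> w; rewrite -cylatE; exact: measurable_cylat.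
Qed.

(** Open sets are closed under intersection and generate the sigma-algebra; each is an increasing
    union of sets [F p], which are finite unions of cylinders of length [n + p k]. *)
Lemma measure_ext (mu1 mu2 : {measure set Xmeas -> \bar R}) :
  (mu1 setT < +oo)%E ->
  (forall p x, mu1 (cylat (n + p * k) x) = mu2 (cylat (n + p * k) x)) ->
  forall S, measurable S -> mu1 S = mu2 S.
Proof.
move=> fin mu12; apply: (@measure_unique _ R Xmeas (@opn A a0) (fun=> setT)) => //.
- exact: opn_setI.
- by move=> _ x _; exists 0%N.
- by rewrite bigcup_const //; exists 0%N.
move=> U oU; pose F p : set Xmeas := [set x | cylat (n + p * k) x `<=` U].
have FL p x y : agree x y (n + p * k) -> F p x -> F p y.
  by move=> xy Fx z yz; apply: Fx; exact: agree_trans xy yz.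
have mF p : measurable (F p) by exact: cylinder_measurable (FL p).
have UE : \bigcup_p F p = U.
  apply/seteqP; split=> [x [p _]|x /oU[p Up]]; first by apply; exact: agree_refl.
  by exists p => // y xy; apply: Up; apply: agree_le xy; nia.
have ndF : nondecreasing_seq F.
  by move=> p q pq; apply/subsetPset => x Fx y xy; apply: Fx; apply: agree_le xy; nia.
have cvgF (mu : {measure set Xmeas -> \bar R}) : mu \o F @ \oo --> mu U.
  by rewrite -UE; apply: nondecreasing_cvg_mu => //; rewrite UE; exact: opn_measurable.
have FE : mu1 \o F = mu2 \o F.
  apply/funext => p /=; rewrite !(measure_partition (n + p * k) _ (mF p)).
  apply: eq_bigr => w _; have [Fw|Fw] := pselect (F p (wext w)).
    rewrite (_ : _ `&` _ = cylat (n + p * k) (wext w)) //; apply/setIidl => y.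
    by move=> wy; exact: FL Fw.
  rewrite (_ : _ `&` _ = set0) ?measure0 //; apply/seteqP; split=> // y [wy Fy].
  by apply: Fw; apply: FL Fy; exact: agree_sym.
by apply: (cvg_unique _ (cvgF mu1)) => //; rewrite FE; exact: cvgF.
Qed.

Context {lam : word A n -> probability Xmeas R}.
Hypothesis hlam : forall (s : word A n) (p : nat) (sb : 'I_p -> word A k),
  lam s (cyl_ext a0 s sb) = ((#|A|%:R : R) ^- (p * k))%:E.

Lemma lam_cylat s p x :
  lam s (cylat (n + p * k) x) = (if J x == s then (#|A|%:R : R) ^- (p * k) else 0)%:E.
Proof.
case: eqVneq => [<-|xs].
  rewrite -(hlam (J x) (fun j : 'I_p => [ffun l : 'I_k => x (n + j * k + l)%N])).
  congr (lam _ _); apply/seteqP; split=> y /=.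
    move=> xy; split=> [i|j l]; rewrite ffunE xy //; first exact: ltn_addr.
    by have := ltn_ord j; have := ltn_ord l; nia.
  move=> [yx yj] i ip; case: (ltnP i n) => ni.
    by have := yx (Ordinal ni); rewrite ffunE.
  have jp : ((i - n) %/ k < p)%N by rewrite ltn_divLR //; lia.
  have lk : ((i - n) %% k < k)%N by rewrite ltn_mod.
  have := yj (Ordinal jp) (Ordinal lk); rewrite ffunE /=.
  by rewrite -addnA -divn_eq subnKC.
apply/eqP; rewrite eq_le measure_ge0 andbT.
(* The case [p = 0] of [hlam] gives full mass to the cylinder of [s], which misses the cylinder of
   [x]. *)
have s1 : lam s (cylat n (wext s)) = 1%E.
  rewrite -[RHS](_ : ((#|A|%:R : R) ^- (0 * k))%:E = _); last by rewrite mul0n expr0 invr1.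
  rewrite -(hlam s (fun j : 'I_0 => [ffun=> a0])); congr (lam _ _).
  apply/seteqP; split=> y /=.
    by move=> sy; split=> [i|[]//]; rewrite -sy ?ltn_ord // /wext watE.
  by move=> [ys _] i ni; rewrite (ys (Ordinal ni)) /wext -(watE (a0 := a0)).
have := probability_setC (lam s) (measurable_cylat n (wext s)); rewrite s1.
rewrite subee // => s0; rewrite -[leRHS]s0; apply: le_measure; rewrite ?inE //.
- exact: measurable_cylat.
- by apply: measurableC; exact: measurable_cylat.
move=> y xy sy; move/eqP: xs; apply.
rewrite -(prefix_wext (a0 := a0) s); apply/agreeP => i ni.
by rewrite sy // xy //; lia.
Qed.

(** As functions of [S] both sides are finite measures, so comparing them on cylinders is enough;
    there [spliceP] turns the left side into the mass of a single cylinder. *)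
Lemma lam_markov s q x (S : set Xmeas) : measurable S ->
  lam s (cylat (n + q * k) x `&` iter q g @^-1` S) =
  (lam s (cylat (n + q * k) x) * lam (J (iter q g x)) S)%E.
Proof.
move=> mS; set t := J _; have mC := measurable_cylat (n + q * k) x.
rewrite lam_cylat; case: (eqVneq (J x) s) => [xs|xs]; last first.
  rewrite mul0e; apply/eqP; rewrite eq_le measure_ge0 andbT.
  have l0 := lam_cylat s q x; rewrite (negbTE xs) in l0; rewrite -[leRHS]l0.
  apply: le_measure; rewrite ?inE //; apply: measurableI => //.
  by rewrite -[X in measurable X]setTI; exact: measurable_iter_g.
have r0 : 0 <= (#|A|%:R : R) ^- (q * k) by rewrite invr_ge0 exprn_ge0.
pose mu1 := pushforward (mrestr (lam s) mC) (iter q g : Xmeas -> Xmeas).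
pose mu2 := mscale (NngNum r0) (lam t).
rewrite setIC -[LHS]/(mu1 S) -[RHS]/(mu2 S).
unshelve refine (@measure_ext mu1 mu2 _ _ S mS).
- exact: measurable_iter_g.
- rewrite /mu1 /pushforward /mrestr.
  apply: le_lt_trans (probability_le1 (lam s) _) (ltry 1).
  exact: (measurableI _ _ measurableT mC).
move=> p y; rewrite -[LHS]/(lam s (iter q g @^-1` cylat (n + p * k) y `&` cylat (n + q * k) x)).
rewrite -[RHS]/(((#|A|%:R : R) ^- (q * k))%:E * lam t (cylat (n + p * k) y))%E lam_cylat.
have -> : iter q g @^-1` cylat (n + p * k) y `&` cylat (n + q * k) x =
    if J (iter q g x) == J y then cylat (n + (p + q) * k) (@splice _ _ n k q x y) else set0.
  rewrite mulnDl addnA; apply/seteqP; split=> [z [yz xz]|z].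
    have [|xy sz] := (@spliceP _ _ _ _ gam hn hk q _ x y z (leq_addr (p * k) n)).1; first by split.
    by rewrite xy eqxx.
  case: eqVneq => // xy sz.
  by have [|? ?] := (@spliceP _ _ _ _ gam hn hk q _ x y z (leq_addr (p * k) n)).2; split.
rewrite eq_sym; case: eqVneq => [yt|_]; last by rewrite measure0 mule0.
rewrite lam_cylat -xs ifT; first by rewrite mulnDl exprD invfM -EFinM mulrC.
apply/eqP/agreeP/agree_sym; apply: agree_le (@agree_splice _ _ n k q x y); exact: leq_addr.
Qed.

Definition lamr s (S : set Xmeas) : R := fine (lam s S).

Lemma lamrE s (S : set Xmeas) : measurable S -> lam s S = (lamr s S)%:E.
Proof. by move=> mS; rewrite fineK //; exact: fin_num_measure. Qed.

Lemma lamr_cylat s p x :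
  lamr s (cylat (n + p * k) x) = if J x == s then (#|A|%:R : R) ^- (p * k) else 0.
Proof. by rewrite /lamr lam_cylat. Qed.

Lemma lamr_ge0 s S : 0 <= lamr s S.
Proof. by rewrite fine_ge0. Qed.

Lemma lamrT s : lamr s setT = 1.
Proof. by rewrite /lamr probability_setT. Qed.

Lemma lamr_markov s q x (S : set Xmeas) : measurable S ->
  lamr s (cylat (n + q * k) x `&` iter q g @^-1` S) =
  lamr s (cylat (n + q * k) x) * lamr (J (iter q g x)) S.
Proof.
move=> mS; rewrite /lamr lam_markov // fineM ?fin_num_measure //.
exact: measurable_cylat.
Qed.

Lemma measurable_preimage_g (S : set Xmeas) :
  measurable S -> measurable (g @^-1` S : set Xmeas).
Proof. by move=> mS; rewrite -[X in measurable X]setTI; exact: measurable_g. Qed.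

Lemma lamr_partition L s (S : set Xmeas) : measurable S ->
  lamr s S = \sum_(w : word A L) lamr s (cylat L (wext w) `&` S).
Proof.
move=> mS; apply: EFin_inj; rewrite -lamrE // -sumEFin (measure_partition L) //.
by apply: eq_bigr => w _; apply: lamrE; apply: measurableI => //; exact: measurable_cylat.
Qed.

(** Each word [w] of length [n + k] starting with [s] has mass [N^-k], and on its cylinder the image
    under [g] has law [lam (gam w)]. Grouping the words by [gam w] produces the counts in [Gam]. *)
Lemma lamr_preimage s (S : set Xmeas) : measurable S ->
  lamr s (g @^-1` S) = \sum_t Gam gam t s * lamr t S.
Proof.
move=> mS; rewrite (lamr_partition (n + k)); last exact: measurable_preimage_g.
rewrite (partition_big gam predT) //=; apply: eq_bigr => t _.
rewrite /Gam -sum1_card natr_sum mulr_sumr mulr_suml big_mkcond [RHS]big_mkcond /=.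
apply: eq_bigr => w _; rewrite finset.inE; have [wt|_] := eqVneq (gam w) t; last by rewrite andbF.
have := lamr_markov s 1 (wext w) mS; rewrite mul1n /= J_g prefix_wext wt => ->.
have := lamr_cylat s 1 (wext w); rewrite mul1n => ->.
by rewrite -(Jn_prefix (k := k)) prefix_wext andbT; case: ifP => _; rewrite ?mulr1 ?mul0r.
Qed.

Lemma Gam_ge0 s t : 0 <= Gam gam t s :> R.
Proof. by rewrite mulr_ge0 // invr_ge0 exprn_ge0. Qed.

Lemma card_alphabet_gt0 : 0 < #|A|%:R :> R.
Proof. by rewrite ltr0n; apply/card_gt0P; exists a0. Qed.

Lemma Gam_gt0 s t : (0 < Gam gam t s :> R) = G s t.
Proof.
rewrite pmulr_rgt0 ?invr_gt0 ?exprn_gt0 ?card_alphabet_gt0 // ltr0n.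
by apply/card_gt0P/existsP => -[w]; [rewrite finset.inE; exists w|exists w; rewrite finset.inE].
Qed.

Lemma sum_Gam s : \sum_t Gam gam t s = 1 :> R.
Proof.
rewrite -(lamrT s) -[in RHS](preimage_setT g) lamr_preimage //.
by apply: eq_bigr => t _; rewrite lamrT mulr1.
Qed.

End MarkovMeasures.

(** * Invariance, ergodicity, support and transience *)

(** At a maximum point the successors have values at most the maximum and an average at least as
    large, so each of them is again a maximum point; this propagates along paths. *)
Lemma max_principle {R : realType} {T : finType} {F : rel T} {P : T -> T -> R}
    {D : {set T}} {f : T -> R} s0 :
  (forall s t, 0 <= P s t) -> (forall s, \sum_t P s t = 1) ->
  (forall s t, (0 < P s t) = F s t) -> (forall s t, s \in D -> F s t -> t \in D) ->
  (forall s, s \in D -> f s <= \sum_t P s t * f t) ->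
  s0 \in D -> (forall t, t \in D -> f t <= f s0) ->
  forall t, connect F s0 t -> f t = f s0.
Proof.
move=> P0 P1 PF DF sub s0D fmax t.
have step s u : s \in D -> f s = f s0 -> F s u -> f u = f s0.
  move=> sD fs su; pose h w := P s w * (f s0 - f w).
  have h0 w : true -> 0 <= h w.
    move=> _; have := P0 s w; rewrite le_eqVlt /h => /predU1P[<-|]; first by rewrite mul0r.
    by rewrite PF => sw; rewrite mulr_ge0 // subr_ge0; apply: fmax; exact: DF sw.
  have : \sum_w h w = 0.
    apply/eqP; rewrite eq_le sumr_ge0 // andbT /h.
    under eq_bigr do rewrite mulrBr.
    by rewrite sumrB -mulr_suml P1 mul1r subr_le0 -fs sub.
  move/(psumr_eq0P h0)/(_ u isT)/eqP; rewrite mulf_eq0 gt_eqF ?PF //= subr_eq0.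
  by move/eqP.
suff path_eq p s : s \in D -> f s = f s0 -> path F s p -> f (last s p) = f s0.
  by case/connectP => p sp ->; exact: path_eq sp.
elim: p s => //= u p IH s sD fs /andP[su up].
by apply: IH up; [exact: DF su|exact: step su].
Qed.

Section TerminalMeasures.
Context {R : realType} {A : finType} {a0 : A} {n k : nat}.
Context {gam : word A (n + k) -> word A n}.
Hypothesis (hn : (0 < n)%N) (hk : (0 < k)%N).
Local Notation X := (@seqsp A a0).
Local Notation Xmeas := (Xm a0).
Local Notation g := (gmap a0 gam).
Local Notation J := (@Defs.prefix A a0 n).
Local Notation G := (Grel gam).
Implicit Types (x y z : X) (B : {set word A n}).
Context {lam : word A n -> probability Xmeas R}.
Hypothesis hlam : forall (s : word A n) (p : nat) (sb : 'I_p -> word A k),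
  lam s (cyl_ext a0 s sb) = ((#|A|%:R : R) ^- (p * k))%:E.
Local Notation lamr := (@lamr R A a0 n lam).

(** Descending induction on the length, from some [n + p k] at which only [s = J x] contributes;
    each step sums over the next letter. *)
Lemma bernoulli_cylat L x :
  \sum_(s : word A n) (#|A|%:R : R) ^- n * lamr s (cylat L x) = #|A|%:R ^- L.
Proof.
have N0 := card_alphabet_gt0 (R := R) (a0 := a0).
have [p Lp] : exists p, (L <= n + p * k)%N by exists L; nia.
rewrite -(subKn Lp); elim: (n + p * k - L)%N (leq_subr L (n + p * k)) x => [|d IH] dp x.
  rewrite subn0 (bigD1 (J x)) //= lamr_cylat // eqxx big1 ?addr0; last first.
    by move=> s sx; rewrite lamr_cylat // eq_sym (negbTE sx) mulr0.
  by rewrite exprD invfM.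
set L' := (_ - d.+1)%N; have L'E : (n + p * k - d)%N = L'.+1 by rewrite /L'; lia.
pose upd a : X := fun i => if i == L' then a else x i.
have updE s : lamr s (cylat L' x) = \sum_(a : A) lamr s (cylat L'.+1 (upd a)).
  apply: EFin_inj; rewrite -lamrE; last exact: measurable_cylat.
  rewrite -sumEFin (measure_fibers (f := fun y : X => y L')); last exact: measurable_cylat.
    apply: eq_bigr => a _; rewrite -lamrE; last exact: measurable_cylat.
    congr (lam s _); apply/seteqP; split=> [y [ya xy] i|y xy].
      by rewrite ltnS leq_eqVlt /upd; case: eqVneq => [-> _|_ /=]; [rewrite -ya|exact: xy].
    split=> [|i iL]; first by rewrite /= -xy // /upd eqxx.
    by have := xy i (ltnW iL); rewrite /upd ifF // ltn_eqF.
  by move=> a; apply: (@cylinder_measurable _ _ L'.+1) => y z yz /= <-; rewrite yz.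
under eq_bigr do rewrite updE mulr_sumr.
rewrite exchange_big /=; under eq_bigr do rewrite -L'E IH ?(ltnW dp) //.
rewrite sumr_const L'E -[LHS]mulr_natr exprS invfM mulrAC mulVf ?mul1r //.
exact: lt0r_neq0.
Qed.

Lemma lamr_eq0 s (S : set Xmeas) : measurable S -> (forall x, S x -> J x <> s) ->
  lamr s S = 0.
Proof.
move=> mS Ss; rewrite (lamr_partition n) //; apply: big1 => w _.
have [->|ws] := eqVneq w s.
  rewrite (_ : _ `&` _ = set0) ?/lamr ?measure0 //.
  apply/seteqP; split=> // y [wy /Ss]; apply.
  by rewrite -(prefix_wext (a0 := a0) s); apply/agreeP/agree_sym.
have mC := measurable_cylat n (wext w : X).
apply/eqP; rewrite eq_le lamr_ge0 andbT -lee_fin -lamrE; last exact: measurableI.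
apply: (@le_trans _ _ (lam s (cylat n (wext w)))).
  apply: le_measure; last exact: subIsetl.
    by rewrite inE; exact: measurableI mC mS.
  by rewrite inE.
have := lam_cylat hn hk hlam s 0 (wext w); rewrite mul0n addn0 => ->.
by rewrite prefix_wext (negbTE ws).
Qed.

Lemma lamr_le s (S S' : set Xmeas) : measurable S -> measurable S' -> S `<=` S' ->
  lamr s S <= lamr s S'.
Proof.
by move=> mS mS' SS'; rewrite -lee_fin -!lamrE //; apply: le_measure; rewrite ?inE.
Qed.

(** Recurrence in the sense of Markov chains: membership in a terminal class, not merely in a cycle
    of [G]. *)
Definition recurrent : {set word A n} :=
  finset (fun s => `[< exists B, [/\ fbasic G B, fterminal G B & s \in B] >]).

Lemma cylinder_J (P : pred (word A n)) q :
  measurable ([set x : X | P (J (iter q g x))] : set Xmeas).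
Proof.
apply: (@cylinder_measurable _ _ (n + q * k)) => x y xy /=.
by have /agreeP -> : agree (iter q g x) (iter q g y) n by exact: agree_iter_g.
Qed.

(* The probability of never entering a terminal class is subharmonic and
   vanishes on terminal classes, which are reachable from any maximum point. *)
Lemma lamr_transient s :
  lamr s (\bigcap_q [set x : X | J (iter q g x) \notin recurrent]) = 0.
Proof.
set D := \bigcap_q _.
have mD : measurable (D : set Xmeas).
  by apply: bigcapT_measurable => q; exact: cylinder_J (fun s => s \notin recurrent) q.
pose f t := lamr t D.
(* If an orbit avoids the terminal classes forever, so does the orbit of the image point. *)
have fsub t : f t <= \sum_u Gam gam u t * f u.
  rewrite -lamr_preimage //; apply: lamr_le => //; first exact: measurable_preimage_g.
  by move=> x Dx q _; have := Dx q.+1 I; rewrite /= -iterSr.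
have f0 t : t \in recurrent -> f t = 0.
  by move=> tr; apply: lamr_eq0 => // x /(_ 0%N I) /= xr xt; rewrite xt tr in xr.
have [u _ umax] := @arg_maxP _ _ _ s predT f isT.
have [B [t [fB tB ut tBt]]] := reach_fterminal u (@Grel_total _ a0 _ _ gam).
have : f t = f u.
  apply: (max_principle (f := f) (D := finset.setTfor (word A n))
    (P := fun s t => Gam gam t s) (F := G)) ut.
  - by move=> *; exact: Gam_ge0.
  - exact: (sum_Gam hn hk hlam).
  - by move=> *; exact: (Gam_gt0 (a0 := a0)).
  - by move=> *; exact: finset.in_setT.
  - by move=> ? _; exact: fsub.
  - exact: finset.in_setT.
  - by move=> ? _; exact: umax.
rewrite (f0 t) => [u0|]; last by rewrite finset.inE; apply/asboolP; exists B.
by apply/eqP; rewrite eq_le lamr_ge0 andbT u0; exact: umax.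
Qed.

Section FixedTerminalClass.
Context {B : {set word A n}} {v : word A n -> R} {mu : probability Xmeas R}.
Hypothesis (fB : fbasic G B) (tB : fterminal G B).
Hypothesis hv : stat_dist (Gam gam) B v.
Hypothesis hmu : forall S : set Xmeas, mu S = (\sum_(s in B) (v s)%:E * lam s S)%E.

Lemma stat_dist_notin s : s \notin B -> v s = 0.
Proof.
have [v0 _ _ vB] := hv; rewrite -vB -leNgt => vs.
by apply/eqP; rewrite eq_le vs v0.
Qed.

Lemma mixtureE (S : set Xmeas) : measurable S -> mu S = (\sum_s v s * lamr s S)%:E.
Proof.
move=> mS; rewrite hmu -sumEFin big_mkcond; apply: eq_bigr => s _.
by case: ifPn => sB; [rewrite EFinM -lamrE|rewrite stat_dist_notin ?mul0r].
Qed.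

Lemma mixture_invariant : g_invariant g mu.
Proof.
move=> S mS; rewrite -[LHS]/(mu _) -[RHS]/(mu _) !mixtureE //; last exact: measurable_preimage_g.
have [_ _ vP _] := hv; congr EFin.
under eq_bigr do rewrite lamr_preimage // mulr_sumr.
rewrite exchange_big /=; apply: eq_bigr => t _.
rewrite -vP mulr_suml; apply: eq_bigr => s _; by rewrite mulrCA mulrA.
Qed.

(** For invariant [S] the preimage formula makes [lamr s S] harmonic in [s]. Terminality closes [B]
    under successors, and a maximum point in [B] reaches all of [B]. *)
Lemma lamr_invariant_const (S : set Xmeas) : measurable S -> g @^-1` S = S ->
  forall s t, s \in B -> t \in B -> lamr s S = lamr t S.
Proof.
move=> mS gS; have [r rB] := fbasic_neq0 fB.
have [u uB umax] := @arg_maxP _ _ _ r (mem B) (fun t => lamr t S) rB.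
suff E s : s \in B -> lamr s S = lamr u S by move=> s t sB tB'; rewrite !E.
move=> sB.
apply: (max_principle (f := fun t => lamr t S) (D := B)
  (P := fun s t => Gam gam t s) (F := G) (s0 := u)).
- by move=> *; exact: Gam_ge0.
- exact: (sum_Gam hn hk hlam).
- by move=> *; exact: (Gam_gt0 (a0 := a0)).
- by move=> t w tB' /OF1; exact: tB.
- by move=> t _; rewrite -lamr_preimage // gS.
- exact: uB.
- exact: umax.
by apply: OF_connect; exact: (fbasic_OF fB).
Qed.

(* By the Markov property, an invariant set is independent of all cylinders,
   hence of itself. *)
Lemma mixture_ergodic : g_ergodic g mu.
Proof.
move=> S mS gS; have [r rB] := fbasic_neq0 fB; set c := lamr r S.
have cE s : s \in B -> lamr s S = c.
  by move=> sB; exact: lamr_invariant_const.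
have igS q : iter q g @^-1` S = S.
  elim: q => // q IH; by rewrite -[RHS]IH -[in RHS]gS.
(* Restricting [lam r] to [S] multiplies the mass of every cylinder by [c], since orbits starting
   over [r] stay over [B]; evaluating at [S] itself gives the equation. *)
have cc : c = c * c.
  have c0 : 0 <= c by exact: lamr_ge0.
  pose mu1 := mrestr (lam r) mS.
  pose mu2 := mscale (NngNum c0) (lam r).
  have : mu1 S = mu2 S.
    unshelve refine (@measure_ext R A a0 n k hn hk mu1 mu2 _ _ S mS).
      rewrite /mu1 /mrestr; apply: le_lt_trans (probability_le1 (lam r) _) (ltry 1).
      exact: (measurableI _ _ measurableT mS).
    move=> p x; have mC := measurable_cylat (n + p * k) x.
    rewrite -[LHS]/(lam r (cylat (n + p * k) x `&` S)) -[RHS]/(c%:E * lam r (cylat (n + p * k) x))%E.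
    rewrite !lamrE //; last exact: measurableI.
    rewrite -EFinM -{1}(igS p) lamr_markov //; congr EFin.
    rewrite lamr_cylat //; case: eqVneq => [xr|_]; last by rewrite mul0r mulr0.
    by rewrite mulrC cE //; apply: fterminal_J => //; rewrite xr.
  rewrite -[LHS]/(lam r (S `&` S)) -[RHS]/(c%:E * lam r S)%E setIid.
  by rewrite lamrE // -EFinM => -[].
have muS : mu S = c%:E.
  rewrite hmu; under eq_bigr => s sB do rewrite lamrE // cE // -EFinM.
  rewrite sumEFin -mulr_suml; have [_ v1 _ _] := hv; congr EFin.
  rewrite -[RHS]mul1r -v1 [in RHS](bigID (mem B)) /= [X in _ = (_ + X) * _]big1 ?addr0 //.
  by move=> s; exact: stat_dist_notin.
rewrite -[_ S]/(mu S) muS; move/eqP: cc; rewrite -{1}[c]mulr1 -subr_eq0 -mulrBr mulf_eq0 subr_eq0.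
by move=> /orP[/eqP ->|/eqP <-]; [left|right].
Qed.

(** Off [B], the cylinder of length [n] around the point is null. Over [B], every neighbourhood
    contains a cylinder whose mass is at least [v (J x) N^-(p k)]. *)
Lemma mixture_support : msupport mu = [set x | J x \in B].
Proof.
apply/seteqP; split=> x /=.
  move=> /(_ (cylat n x)) xP; apply/negPn/negP => xB.
  have oC : @opn A a0 (cylat n x).
    by apply: (@cylinder_opn A a0 n (cylat n x)) => y z yz xy; exact: agree_trans xy yz.
  have : (0 < mu (cylat n x))%E := xP oC (@agree_refl _ _ _ _).
  rewrite hmu big1 ?ltxx // => s sB.
  have := lam_cylat hn hk hlam s 0 x; rewrite mul0n addn0 => ->.
  by rewrite ifF ?mule0 //; apply: contraNF xB => /eqP ->.
move=> xB U oU Ux; have [p Up] := oU x Ux.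
have mC := measurable_cylat (n + p * k) x.
apply: (@lt_le_trans _ _ (mu (cylat (n + p * k) x))); last first.
  apply: le_measure; rewrite ?inE //; first exact: opn_measurable.
  by move=> y xy; apply: Up; apply: agree_le xy; nia.
have [v0 _ _ vB] := hv; rewrite mixtureE // lte_fin (bigD1 (J x)) //=.
apply: ltr_wpDr; first by apply: sumr_ge0 => s _; rewrite mulr_ge0 // lamr_ge0.
rewrite lamr_cylat // eqxx mulr_gt0 ?vB // invr_gt0 exprn_gt0 //.
exact: (card_alphabet_gt0 (a0 := a0)).
Qed.

End FixedTerminalClass.
End TerminalMeasures.

(** * Ergodic sums *)

Lemma bounded_integrable d (T : measurableType d) (R : realType)
    {mu : probability T R} (f : T -> R) C :
  measurable_fun setT f -> (forall x, `|f x| <= C) ->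
  mu.-integrable setT (EFin \o f).
Proof.
move=> mf fC; apply: measurable_bounded_integrable => //.
  by rewrite (le_lt_trans (probability_le1 mu _) (ltry 1)).
by exists C; split; [exact: num_real|move=> M /ltW CM x _; exact: le_trans CM].
Qed.

Section MaximalErgodic.
Context d (T : measurableType d) (R : realType) (mu : probability T R) (g : T -> T).
Hypothesis mg : measurable_fun setT g.
Hypothesis g_inv : forall S, measurable S -> mu (g @^-1` S) = mu S.
Hypothesis g_erg : forall S, measurable S -> g @^-1` S = S -> mu S = 0%E \/ mu S = 1%E.
Context (f : T -> R) (C : R).
Hypotheses (mf : measurable_fun setT f) (fC : forall x, `|f x| <= C).

(** The maximum of [0] and the Birkhoff sums of [f] of lengths [1] to [m]. *)
Fixpoint maxsum m x : R := if m is p.+1 then Num.max 0 (f x + maxsum p (g x)) else 0.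

Lemma maxsum_ge0 m x : 0 <= maxsum m x.
Proof. by case: m => //= m; rewrite le_max lexx. Qed.

Lemma le_maxsumS m x : maxsum m x <= maxsum m.+1 x.
Proof.
elim: m x => [|m IH] x; first by rewrite /= le_max lexx.
by apply: le_max2 => //; rewrite lerD2l IH.
Qed.

Lemma le_maxsum m p x : (m <= p)%N -> maxsum m x <= maxsum p x.
Proof.
by move/subnKC <-; elim: (p - m)%N => [|i /le_trans IH]; rewrite ?addn0 // addnS IH ?le_maxsumS.
Qed.

Lemma sum_le_maxsum m x : \sum_(i < m) f (iter i g x) <= maxsum m x.
Proof.
elim: m x => [|m IH] x; first by rewrite big_ord0.
rewrite big_ord_recl /= le_max; apply/orP; right; rewrite lerD2l.
by apply: le_trans (IH (g x)); rewrite le_eqVlt; apply/orP; left; apply/eqP;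
  apply: eq_bigr => i _; rewrite -iterSr.
Qed.

Lemma maxsum_bound m x : `|maxsum m x| <= C *+ m.
Proof.
rewrite ger0_norm ?maxsum_ge0 //; elim: m x => [|m IH] x //=.
have C0 : 0 <= C by exact: le_trans (fC x).
rewrite ge_max mulrn_wge0 //= mulrS lerD //; exact: le_trans (ler_norm _) (fC x).
Qed.

Lemma measurable_maxsum m : measurable_fun setT (maxsum m).
Proof.
elim: m => [|m IH] /=; first exact: measurable_cst.
apply: measurable_maxr; first exact: measurable_cst.
by apply: measurable_funD => //; exact: measurableT_comp IH mg.
Qed.

Definition maxsum_unbounded : set T := [set x | forall K : R, exists m, K < maxsum m x].

Lemma maxsum_unbounded_measurable : measurable maxsum_unbounded.
Proof.
have -> : maxsum_unbounded =
    \bigcap_K \bigcup_m (maxsum m @^-1` `](K%:R : R), +oo[%classic).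
  apply/seteqP; split=> x /= xE K.
    by move=> _; have [m Km] := xE K%:R; exists m; rewrite //= in_itv /= Km.
  have [m _] := xE (Num.bound `|K|) I; rewrite /= in_itv /= andbT => Km; exists m.
  by apply: lt_trans Km; apply: le_lt_trans (ler_norm K) _; exact: archi_boundP.
apply: bigcapT_measurable => K; apply: bigcupT_measurable => m.
rewrite -[X in measurable X]setTI; apply: measurable_maxsum => //.
Qed.

(** [maxsum m.+1 x] and [maxsum m (g x)] differ by at most [C]. *)
Lemma maxsum_unbounded_invariant : g @^-1` maxsum_unbounded = maxsum_unbounded.
Proof.
apply/seteqP; split=> x /= xE K.
  have [m Km] := xE (K + C); exists m.+1 => /=; rewrite lt_max; apply/orP; right.
  by have := fC x; rewrite ler_norml => /andP[]; lra.
(* The threshold [|K| + C] is nonnegative, which rules out [m = 0] and the value [0] of the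
   maximum. *)
have [[|m]] := xE (`|K| + C).
  by have := fC x; have := normr_ge0 (f x); have := normr_ge0 K; rewrite /=; lra.
rewrite /= lt_max => /orP[|Km].
  by have := fC x; have := normr_ge0 (f x); have := normr_ge0 K; lra.
by exists m; have := fC x; have := ler_norm (f x); have := ler_norm K; lra.
Qed.

Lemma integrable_maxsum m : mu.-integrable setT (EFin \o maxsum m).
Proof. exact: bounded_integrable (measurable_maxsum m) (maxsum_bound m). Qed.

Lemma integral_maxsum_g m :
  (\int[mu]_x (maxsum m (g x))%:E = \int[mu]_x (maxsum m x)%:E)%E.
Proof.
have mM : measurable_fun setT (EFin \o maxsum m) by exact/measurable_EFinP/measurable_maxsum.
rewrite -[LHS](ge0_integral_pushforward mg mu measurableT mM); last first.
  by move=> x _; rewrite lee_fin maxsum_ge0.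
by apply: eq_measure_integral => S mS _; exact: g_inv.
Qed.

Lemma maxsum_unbounded_null : (\int[mu]_x (f x)%:E < 0)%E -> mu maxsum_unbounded = 0%E.
Proof.
move=> f0; have [//|E1] := g_erg maxsum_unbounded_measurable maxsum_unbounded_invariant.
pose h m x : R := maxsum m.+1 x - maxsum m (g x).
have mMg m : measurable_fun setT (fun x => maxsum m (g x)).
  exact: measurableT_comp (measurable_maxsum m) mg.
have mh m : measurable_fun setT (h m).
  by apply: measurable_funB => //; exact: measurable_maxsum.
have hE m x : h m x = Num.max (- maxsum m (g x)) (f x).
  by rewrite /h /= addr_maxl sub0r addrK.
have hC m x : `|h m x| <= C.
  rewrite hE ler_norml; have := fC x; rewrite ler_norml => /andP[fx xf].
  rewrite le_max fx orbT ge_max xf andbT /=.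
  by have := maxsum_ge0 m (g x); lra.
have int_h m : (0 <= \int[mu]_x (h m x)%:E)%E.
  have iMg : mu.-integrable setT (EFin \o (fun x => maxsum m (g x))).
    by apply: bounded_integrable (mMg m) _ => x; exact: maxsum_bound.
  rewrite /h; under eq_integral do rewrite EFinB.
  rewrite integralB_EFin //; last exact: integrable_maxsum.
  rewrite integral_maxsum_g -integralB_EFin //; [|exact: integrable_maxsum..].
  by apply: integral_ge0 => x _; rewrite -EFinB lee_fin subr_ge0 le_maxsumS.
have h_f : {ae mu, forall x, setT x -> (EFin \o h ^~ x) @ \oo --> (f x)%:E}.
  exists (~` maxsum_unbounded); split.
  - by apply: measurableC; exact: maxsum_unbounded_measurable.
  - by rewrite probability_setC ?E1 ?subee //; exact: maxsum_unbounded_measurable.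
  move=> x /= xh xE; apply: xh => _.
  (* Once [maxsum m (g x)] exceeds [C], the maximum in [hE] is [f x], so the convergence is an
     eventual equality. *)
  have [m Cm] : exists m, C < maxsum m (g x).
    by move: xE; rewrite -maxsum_unbounded_invariant; exact.
  apply: cvg_near_cst; exists m => // p /= mp; rewrite hE max_r //.
  have := fC x; rewrite ler_norml => /andP[? _].
  by have := le_maxsum (g x) mp; lra.
have [_ _ cvg_h] := @dominated_convergence _ T R mu setT measurableT
  (fun m => EFin \o h m) (EFin \o f) (cst C%:E)
  (fun m => (measurable_EFinP _ _).2 (mh m)) ((measurable_EFinP _ _).2 mf) h_f
  (finite_measure_integrable_cst mu C measurableT)
  (aeW mu (fun x m _ => hC m x)).
suff : (0 <= \int[mu]_x (f x)%:E)%E by rewrite leNgt f0.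
rewrite -(cvg_lim _ cvg_h) //; apply: lime_ge; first exact/cvg_ex/ex_intro/cvg_h.
by apply: nearW => m; exact: int_h.
Qed.

(* One-sided ergodic theorem.  Write [M_m] for the maximum of [0] and the first
   [m] Birkhoff sums; then [M_(m+1) - M_m \o g = max (- M_m \o g) f] has nonnegative
   integral by invariance, and decreases to [f] where [M_m] is unbounded.  That set is
   invariant, so if it had full measure the integral of [f] would be nonnegative. *)
Lemma birkhoff_sum_bounded : (\int[mu]_x (f x)%:E < 0)%E ->
  mu.-negligible [set x | ~ exists K : R, forall m, \sum_(i < m) f (iter i g x) <= K].
Proof.
move=> f0; exists maxsum_unbounded; split; first exact: maxsum_unbounded_measurable.
  exact: maxsum_unbounded_null.
move=> x xK K; apply: contrapT => xm; apply: xK; exists K => m.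
apply: le_trans (sum_le_maxsum m x) _; rewrite leNgt; apply/negP => Km.
by apply: xm; exists m.
Qed.

End MaximalErgodic.

(** * Generic points *)

Lemma negligible_bigcup_count d (T : measurableType d) (R : realType)
    (mu : {measure set T -> \bar R}) (I : countType) (F : I -> set T) :
  (forall i, mu.-negligible (F i)) -> mu.-negligible (\bigcup_i F i).
Proof.
move=> F0; pose F' m := if @unpickle I m is Some i then F i else set0.
apply: (@negligibleS _ _ _ mu (\bigcup_m F' m)).
  by move=> x [i _ Fx]; exists (pickle i) => //; rewrite /F' pickleK.
apply: negligible_bigcup => m; rewrite /F'; case: unpickle => // [].
exact: negligible_set0.
Qed.

Lemma probability_integral_cst d (T : measurableType d) (R : realType)
    (mu : probability T R) (r : R) : (\int[mu]_x r%:E = r%:E)%E.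
Proof.
rewrite integral_cst // -[RHS]mule1; exact: congr1 (probability_setT mu).
Qed.

Section ContinuousFunctions.
Context {R : realType} {A : finType} {a0 : A}.
Local Notation X := (@seqsp A a0).
Local Notation Xmeas := (Xm a0).
Local Notation prefix := (@Defs.prefix A a0).
Implicit Types (x y z : X).

(* Koenig's lemma: otherwise one builds letter by letter a point all of whose
   cylinders carry an oscillation of at least [e]. *)
Lemma dcontinuous_uniform (u : X -> R) e : dcontinuous u -> 0 < e ->
  exists L, forall x y, agree x y L -> `|u x - u y| < e.
Proof.
move=> cu e0; apply: contrapT => nunif.
pose bad l x := forall L, exists y z,
  [/\ agree x y l, agree y z L & ~ `|u y - u z| < e].
pose upd x l a : X := fun i => if i == l then a else x i.
have step l x : exists a, bad l x -> bad l.+1 (upd x l a).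
  apply: contrapT => noa.
  have good a : exists L, forall y z, agree (upd x l a) y l.+1 -> agree y z L ->
      `|u y - u z| < e.
    apply: contrapT => na; apply: noa; exists a => _ L; apply: contrapT => nyz.
    apply: na; exists L => y z xy yz; apply: contrapT => nu; apply: nyz.
    by exists y, z.
  apply: noa; exists a0 => badx; exfalso; have [Lf Lfp] := choice good.
  (* The largest of the moduli for the one-letter extensions is a modulus for the whole cylinder. *)
  have [y [z [xy yz]]] := badx (\max_a Lf a)%N; apply.
  apply: (Lfp (y l)) => [i|]; last by apply: agree_le yz; exact: leq_bigmax.
  by rewrite ltnS leq_eqVlt /upd; case: eqVneq => [->|_ /=]; last exact: xy.
have [st stP] := choice (fun lx => step lx.1 lx.2).
pose xs := fix xs l : X := if l is j.+1 then upd (xs j) j (st (j, xs j)) else fun=> a0.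
have xs_bad l : bad l (xs l).
  elim: l => [|l IH]; last exact: (stP (l, xs l)).
  move=> L; apply: contrapT => nyz; apply: nunif; exists L => y z yz.
  by apply: contrapT => nu; apply: nyz; exists y, z.
pose om : X := fun i => xs i.+1 i.
have xs_om l : agree (xs l) om l.
  elim: l => // l IH i; rewrite ltnS leq_eqVlt /=; case: eqVneq => [->|il /= li].
    by rewrite /om.
  by rewrite {1}/upd (negbTE il) IH.
have e2 : 0 < e / 2 by rewrite divr_gt0.
have [l lP] := cu om _ e2; have [y [z [xy yz]]] := xs_bad l l; apply.
have omy : agree om y l by apply: agree_trans xy; exact: agree_sym.
have /lP := omy; have /lP := agree_trans omy yz; rewrite !ltr_norml.
by move=> /andP[? ?] /andP[? ?]; apply/andP; split; lra.
Qed.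

Lemma dcontinuous_bounded (u : X -> R) : dcontinuous u -> exists C, forall x, `|u x| <= C.
Proof.
move=> cu; have [L LP] := dcontinuous_uniform cu (@ltr01 R).
exists (1 + \sum_(w : word A L) `|u (wext w)|) => x.
have /ltW := LP _ _ (@wext_prefix A a0 L x); set w := prefix L x.
have : `|u (wext w)| <= \sum_(w : word A L) `|u (wext w)|.
  by rewrite (bigD1 w) //= lerDl sumr_ge0.
by have := lerB_dist (u x) (u (wext w)); rewrite distrC; lra.
Qed.

Lemma dcontinuous_measurable (u : X -> R) : dcontinuous u ->
  measurable_fun setT (u : Xmeas -> R).
Proof.
move=> cu; apply: (@measurability _ _ Xmeas _ setT u _ (RGenOInfty.measurableE R)).
move=> _ [_ [r ->] <-]; rewrite setTI; apply: opn_measurable => x; rewrite /= in_itv /= andbT => rx.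
have ur : 0 < u x - r by rewrite subr_gt0.
have [l lP] := cu x _ ur; exists l => y /lP.
by rewrite /= in_itv /= andbT ltr_norml => /andP[]; lra.
Qed.

(** * Almost every point is generic for an ergodic measure *)

Section Genericity.
Context (mu : probability Xmeas R) (g : X -> X).
Hypothesis mg : measurable_fun setT (g : Xmeas -> Xmeas).
Hypotheses (g_inv : g_invariant g mu) (g_erg : g_ergodic g mu).

Local Notation cyl1 L w := (\1_(@cylat A a0 L (wext w)) : Xmeas -> R).
Local Notation cyl_mass L w := (fine (mu (@cylat A a0 L (wext w)))).

Lemma measurable_cyl1 L (w : word A L) : measurable_fun setT (cyl1 L w).
Proof. by apply: measurable_indic; exact: measurable_cylat. Qed.

Lemma cyl1_bound L (w : word A L) x : `|cyl1 L w x| <= 1.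
Proof. by rewrite indicE ger0_norm ?ler0n // lern1 leq_b1. Qed.

Lemma integrable_cyl1 L (w : word A L) : mu.-integrable setT (EFin \o cyl1 L w).
Proof. exact: bounded_integrable (measurable_cyl1 w) (cyl1_bound w). Qed.

Lemma integral_cyl1 L (w : word A L) : (\int[mu]_x (cyl1 L w x)%:E = (cyl_mass L w)%:E)%E.
Proof.
have mC := @measurable_cylat A a0 L (wext w).
by rewrite integral_indic // setIT fineK //; exact: fin_num_measure.
Qed.

(** The visits before time [m] exceed [m (mass + e)] by a bounded amount only, which is how the
    one-sided ergodic theorem controls a frequency. *)
Definition cyl_frequency_le L (w : word A L) (e : R) x := exists K : R,
  forall m, \sum_(i < m) (cyl1 L w (iter i g x) - (cyl_mass L w + e)) <= K.

Definition cyl_frequency_ge L (w : word A L) (e : R) x := exists K : R,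
  forall m, \sum_(i < m) ((cyl_mass L w - e) - cyl1 L w (iter i g x)) <= K.

(** The summed function has integral [- e], so the one-sided ergodic theorem applies. *)
Lemma ae_cyl_frequency_le L (w : word A L) e : 0 < e ->
  mu.-negligible [set x | ~ cyl_frequency_le w e x].
Proof.
move=> e0; apply: (birkhoff_sum_bounded mg g_inv g_erg
  (f := fun x => cyl1 L w x - (cyl_mass L w + e)) (C := 1 + `|cyl_mass L w + e|)).
- by apply: measurable_funB; [exact: measurable_cyl1|exact: measurable_cst].
- by move=> x; apply: le_trans (ler_normB _ _) _; rewrite lerD2r cyl1_bound.
under eq_integral do rewrite EFinB.
rewrite integralB_EFin //; [|exact: integrable_cyl1|exact: finite_measure_integrable_cst].
rewrite integral_cyl1 probability_integral_cst -EFinB lte_fin; lra.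
Qed.

Lemma ae_cyl_frequency_ge L (w : word A L) e : 0 < e ->
  mu.-negligible [set x | ~ cyl_frequency_ge w e x].
Proof.
move=> e0; apply: (birkhoff_sum_bounded mg g_inv g_erg
  (f := fun x => (cyl_mass L w - e) - cyl1 L w x) (C := `|cyl_mass L w - e| + 1)).
- by apply: measurable_funB; [exact: measurable_cst|exact: measurable_cyl1].
- by move=> x; apply: le_trans (ler_normB _ _) _; rewrite lerD2l cyl1_bound.
under eq_integral do rewrite EFinB.
rewrite integralB_EFin //; [|exact: finite_measure_integrable_cst|exact: integrable_cyl1].
rewrite integral_cyl1 probability_integral_cst -EFinB lte_fin; lra.
Qed.

(** The tolerances [1/(j+1)] keep the conditions countable in number, so that their failures
    together form a null set. *)
Definition regular x := forall L (w : word A L) (j : nat),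
  cyl_frequency_le w j.+1%:R^-1 x /\ cyl_frequency_ge w j.+1%:R^-1 x.

Lemma ae_regular : mu.-negligible [set x | ~ regular x].
Proof.
pose F (i : {L : nat & word A L} * nat) : set Xmeas :=
  [set x | ~ cyl_frequency_le (tagged i.1) i.2.+1%:R^-1 x] `|`
  [set x | ~ cyl_frequency_ge (tagged i.1) i.2.+1%:R^-1 x].
apply: (@negligibleS _ _ _ mu (\bigcup_i F i)); last first.
  apply: negligible_bigcup_count => i; apply: negligibleU.
    by apply: ae_cyl_frequency_le; rewrite invr_gt0.
  by apply: ae_cyl_frequency_ge; rewrite invr_gt0.
move=> x xr; apply: contrapT => nF; apply: xr => L w j.
split; apply: contrapT => h; apply: nF; exists (Tagged (fun L => word A L) w, j) => //.
  by left.
by right.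
Qed.

Lemma regular_frequency x L (w : word A L) e : regular x -> 0 < e ->
  exists K : R, forall m,
    `|\sum_(i < m) (cyl1 L w (iter i g x) - cyl_mass L w)| <= m%:R * e + K.
Proof.
move=> xr e0; have [j je] : exists j : nat, j.+1%:R^-1 < e.
  exists (Num.bound e^-1); rewrite invf_plt ?posrE //.
  have /archi_boundP/lt_trans : 0 <= e^-1 by rewrite invr_ge0 ltW.
  by apply; rewrite ltr_nat.
have [[K1 K1P] [K2 K2P]] := xr L w j; exists (`|K1| + `|K2|) => m.
have mje : m%:R * j.+1%:R^-1 <= m%:R * e :> R by rewrite ler_wpM2l // ltW.
have sc (r : R) : \sum_(i < m) r = m%:R * r by rewrite sumr_const card_ord mulr_natl.
have := K1P m; have := K2P m; rewrite !sumrB !sc mulrDr.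
have := ler_norm K1; have := ler_norm K2; have := normr_ge0 K1; have := normr_ge0 K2.
move: mje (fine _) (\sum_(i < m) _) => /=; move: (m%:R * e) (m%:R : R) (_^-1) => me m' r.
by move=> rme c S *; rewrite ler_norml; apply/andP; split; nra.
Qed.

(** Uniform continuity replaces [u] by a combination [u'] of finitely many cylinder indicators,
    whose averages are controlled by regularity. *)
Lemma regular_generic x : regular x -> generic g mu x.
Proof.
move=> xr u cu; have [C uC] := dcontinuous_bounded cu.
have mu_ := dcontinuous_measurable cu.
have iu : mu.-integrable setT (EFin \o (u : Xmeas -> R)) := bounded_integrable mu_ uC.
rewrite -[X in _ --> X](fineK (integrable_fin_num _ iu)) //.
set I := fine _; apply/fine_cvgP; split; first exact: nearW.
apply/cvgrPdist_le => e e0 /=.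
have e4 : 0 < e / 4 by rewrite divr_gt0.
have [L LP] := dcontinuous_uniform cu e4.
pose uw (w : word A L) := u (wext w); pose D := \sum_w `|uw w|.
have D0 : 0 <= D by exact: sumr_ge0.
(* With this tolerance the weighted errors [|uw w| * e1] add up to at most [e / 4]. *)
pose e1 := e / 4 / (D + 1); have e1_gt0 : 0 < e1 by rewrite divr_gt0 // ltr_wpDl.
have /choice[K KP] (w : word A L) : exists K : R, forall m,
    `|\sum_(i < m) (cyl1 L w (iter i g x) - cyl_mass L w)| <= m%:R * e1 + K.
  exact: regular_frequency.
pose u' (z : Xmeas) := \sum_w uw w * cyl1 L w z.
have u'E z : u' z = u (wext (prefix L z)).
  rewrite /u' (bigD1 (prefix L z)) //= big1 ?addr0.
    by rewrite indicE mem_set ?mulr1 //; exact: wext_prefix.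
  move=> w wz; rewrite indicE memNset ?mulr0 // cylatE /= => zw.
  by rewrite zw eqxx in wz.
have uu' z : `|u z - u' z| <= e / 4.
  by rewrite u'E distrC; apply/ltW/LP; exact: wext_prefix.
pose I' := \sum_w uw w * cyl_mass L w.
have mu' : measurable_fun setT u'.
  by apply: measurable_sum => w; apply: measurable_funM;
    [exact: measurable_cst|exact: measurable_cyl1].
have u'C z : `|u' z| <= C by rewrite u'E.
have iu' := bounded_integrable (mu := mu) mu' u'C.
have intu' : (\int[mu]_z (u' z)%:E = I'%:E)%E.
  rewrite /u' /I' -sumEFin; under eq_integral do rewrite -sumEFin.
  rewrite integral_sum //.
    apply: eq_bigr => w _; under eq_integral do rewrite EFinM.
    by rewrite integralZl ?integral_cyl1 //; exact: integrable_cyl1.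
  move=> w; under eq_fun do rewrite EFinM.
  by apply: integrableZl => //; exact: integrable_cyl1.
have II' : `|I - I'| <= e / 4.
  have -> : I - I' = Rintegral mu setT (fun z => u z - u' z).
    by rewrite RintegralB // /Rintegral intu'.
  apply: le_trans (le_normr_Rintegral _ _) _ => //.
    by apply: bounded_integrable (measurable_funB mu_ mu') uu'.
  rewrite -[leRHS]mulr1 -[X in _ * X](_ : fine (mu setT) = 1); last by rewrite probability_setT.
  rewrite -Rintegral_cst //; apply: le_Rintegral => //.
  - apply: (@bounded_integrable _ _ _ _ _ (e / 4)) => [|z]; last by rewrite normr_id.
    by apply: measurableT_comp => //; exact: measurable_funB.
  - exact: finite_measure_integrable_cst.
pose Kt := \sum_w `|uw w| * K w.
exists (Num.bound (4 * `|Kt| / e)).+1 => //= m mK.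
have m0 : 0 < m%:R :> R by rewrite ltr0n; exact: leq_trans mK.
have mKt : Kt <= m%:R * (e / 4).
  apply: le_trans (ler_norm _) _; rewrite mulrA ler_pdivlMr // [leLHS]mulrC -ler_pdivrMr //.
  have /archi_boundP/ltW/le_trans : 0 <= 4 * `|Kt| / e by rewrite divr_ge0 ?mulr_ge0 // ltW.
  by apply; rewrite ler_nat ltnW.
have sum_u' : `|\sum_(i < m) (u' (iter i g x) - I')| <= m%:R * (e / 4) + Kt.
  rewrite (_ : \sum_(i < m) _ = \sum_w uw w * \sum_(i < m) (cyl1 L w (iter i g x) - cyl_mass L w)).
    apply: le_trans (ler_norm_sum _ _ _) _.
    apply: (@le_trans _ _ (\sum_w `|uw w| * (m%:R * e1 + K w))).
      by apply: ler_sum => w _; rewrite normrM ler_wpM2l.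
    under eq_bigr do rewrite mulrDr.
    rewrite big_split /= lerD2r -mulr_suml -/D mulrCA ler_wpM2l //.
    by rewrite /e1 mulrA ler_pdivrMr ?ltr_wpDl // mulrC ler_pM2l // lerDl.
  under [RHS]eq_bigr do rewrite mulr_sumr.
  rewrite exchange_big /=; apply: eq_bigr => i _.
  by rewrite /u' /I' -sumrB; apply: eq_bigr => w _; rewrite mulrBr.
(* The bound is split into quarters of [m e]: one for [u - u'], two for the sum of [u' - I']
   including [Kt], one for [I' - I]. *)
have sum_u : `|\sum_(i < m) (u (iter i g x) - I)| <= m%:R * e.
  rewrite (_ : \sum_(i < m) _ = \sum_(i < m) (u (iter i g x) - u' (iter i g x)) +
    \sum_(i < m) (u' (iter i g x) - I') + m%:R * (I' - I)); last first.
    rewrite mulr_natl -[X in _ + X](_ : \sum_(i < m) (I' - I) = _); last first.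
      by rewrite sumr_const card_ord.
    by rewrite -!big_split /=; apply: eq_bigr => i _; ring.
  have s1 : `|\sum_(i < m) (u (iter i g x) - u' (iter i g x))| <= m%:R * (e / 4).
    apply: le_trans (ler_norm_sum _ _ _) _.
    rewrite mulr_natl -[leRHS](_ : \sum_(i < m) e / 4 = _); last first.
      by rewrite sumr_const card_ord.
    by apply: ler_sum.
  have s3 : `|m%:R * (I' - I)| <= m%:R * (e / 4).
    by rewrite normrM ger0_norm ?ler0n // ler_wpM2l // distrC.
  apply: le_trans (ler_normD _ _) _; apply: le_trans (lerD (ler_normD _ _) (lexx _)) _.
  by lra.
have -> : I - m%:R^-1 * \sum_(i < m) u (iter i g x) =
    - (m%:R^-1 * \sum_(i < m) (u (iter i g x) - I)).
  rewrite sumrB sumr_const card_ord -[I *+ m]mulr_natl mulrBr mulrA mulVf ?mul1r ?opprB //.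
  exact: lt0r_neq0.
by rewrite normrN normrM ger0_norm ?invr_ge0 ?ler0n // ler_pdivrMl.
Qed.

Lemma ae_generic : mu.-negligible [set x | ~ generic g mu x].
Proof.
apply: negligibleS ae_regular => x xg xr; apply: xg; exact: regular_generic.
Qed.

End Genericity.
End ContinuousFunctions.

(** * Almost every point is generic for the measure of some terminal class *)

Section TypicalPoints.
Context {R : realType} {A : finType} {a0 : A} {n k : nat}.
Context {gam : word A (n + k) -> word A n}.
Hypothesis (hn : (0 < n)%N) (hk : (0 < k)%N).
Local Notation X := (@seqsp A a0).
Local Notation Xmeas := (Xm a0).
Local Notation g := (gmap a0 gam).
Local Notation J := (@Defs.prefix A a0 n).
Local Notation G := (Grel gam).
Context {lam : word A n -> probability Xmeas R}.
Hypothesis hlam : forall (s : word A n) (p : nat) (sb : 'I_p -> word A k),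
  lam s (cyl_ext a0 s sb) = ((#|A|%:R : R) ^- (p * k))%:E.
Context {v : {set word A n} -> word A n -> R}.
Hypothesis hv : forall B, fbasic G B -> fterminal G B -> stat_dist (Gam gam) B (v B).
Context {lamB : {set word A n} -> probability Xmeas R}.
Hypothesis hlamB : forall B, fbasic G B -> fterminal G B ->
  forall S : set Xmeas, lamB B S = (\sum_(s in B) (v B s)%:E * lam s S)%E.

Definition typical (x : X) : Prop :=
  exists B, [/\ fbasic G B, fterminal G B & generic g (lamB B) x].

(** Birkhoff sums from [x] and from [g x] differ by the bounded quantity [u x - u (g^m x)], so the
    averages have the same limit. *)
Lemma generic_iter (mu : {measure set Xmeas -> \bar R}) q (x : X) :
  generic g mu (iter q g x) -> generic g mu x.
Proof.
elim: q => // q IH gx; apply: IH; move: gx; rewrite iterS; move: (iter q g x) => {}x gx u cu.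
have [C uC] := dcontinuous_bounded cu.
pose d m := m%:R^-1 * (u x - u (iter m g x)).
have d0 : (d m)%:E @[m --> \oo] --> 0%E.
  apply/fine_cvgP; split; first exact: nearW.
  apply/cvgrPdist_le => e e0 /=; exists (Num.bound (2 * C / e)).+1 => //= m mK.
  have m0 : 0 < m%:R :> R by rewrite ltr0n; exact: leq_trans mK.
  rewrite sub0r normrN /d normrM ger0_norm ?invr_ge0 ?ler0n // ler_pdivrMl //.
  apply: le_trans (ler_normB _ _) _; apply: (@le_trans _ _ (2 * C)).
    by have := uC x; have := uC (iter m g x); lra.
  rewrite -ler_pdivrMr //; have C0 : 0 <= C by exact: le_trans (uC x).
  have /archi_boundP/ltW/le_trans : 0 <= 2 * C / e by rewrite divr_ge0 ?mulr_ge0 // ltW.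
  by apply; rewrite ler_nat ltnW.
rewrite -[X in _ --> X]adde0.
rewrite (_ : (fun m => _) =
    (fun m => ((m%:R)^-1 * \sum_(i < m) u (iter i g (g x)))%:E + (d m)%:E)%E).
  by apply: cvgeD (gx u cu) d0; exact: fin_num_adde_defl.
apply/funext => m; rewrite -EFinD /d -mulrDr; congr (_ * _)%:E.
case: m => [|m]; first by rewrite !big_ord0 subrr addr0.
rewrite big_ord_recl [X in _ = X + _]big_ord_recr /= -iterSr.
rewrite (eq_bigr (fun i : 'I_m => u (iter i g (g x)))) => [|i _]; last by rewrite /= -iterSr.
by rewrite /=; ring.
Qed.

Lemma lamr0_negligible s (S : set Xmeas) :
  measurable S -> lamr (lam := lam) s S = 0 -> (lam s).-negligible S.
Proof.
move=> mS S0; exists S; split=> //; have := lamrE (lam := lam) s mS.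
by rewrite S0.
Qed.

(** Negligible sets may fail to be measurable, so measurable null covers are intersected over the
    finitely many [t]. The result is null for every [lam t], and the preimage formula applies to
    it. *)
Lemma lam_negligible_preimage (N : set X) :
  (forall s, (lam s).-negligible (N : set Xmeas)) ->
  forall s, (lam s).-negligible (g @^-1` N : set Xmeas).
Proof.
move=> /choice[M MP] s; pose M' := \bigcap_(t in [set: word A n]) M t.
have mM' : measurable (M' : set Xmeas).
  by apply: fin_bigcap_measurable => [|t _]; [exact: finite_finset|have [] := MP t].
have M'0 t : lamr (lam := lam) t M' = 0.
  have [mM M0 _] := MP t; rewrite /lamr; apply/eqP; rewrite fine_eq0 ?fin_num_measure //.
  rewrite eq_le measure_ge0 andbT -M0; apply: le_measure; rewrite ?inE //.
  by move=> x; apply.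
exists (g @^-1` M'); split.
- exact: measurable_preimage_g.
- rewrite lamrE; last exact: measurable_preimage_g.
  by rewrite lamr_preimage // big1 // => t _; rewrite M'0 mulr0.
- by move=> x Nx t _; have [_ _] := MP t; apply.
Qed.

(** Almost every orbit enters some terminal class [B]. Outside a null set it is generic for [lamB B]
    from then on, and genericity passes back to the starting point. *)
Lemma ae_typical s : (lam s).-negligible [set x | ~ typical x].
Proof.
pose N := [set x : X | exists B, [/\ fbasic G B, fterminal G B, J x \in B &
  ~ generic g (lamB B) x]].
have N0 t : (lam t).-negligible (N : set Xmeas).
  have mJ : measurable ([set x : X | J x != t] : set Xmeas).
    exact: (cylinder_J (gam := gam) hn hk (fun s => s != t) 0).
  have J0 : (lam t).-negligible ([set x : X | J x != t] : set Xmeas).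
    by apply: lamr0_negligible (mJ) _; apply: (lamr_eq0 hn hk hlam mJ) => x /eqP.
  have [tr|tr] := pselect (exists B, [/\ fbasic G B, fterminal G B & t \in B]); last first.
    apply: negligibleS J0 => x [B [fB tB xB _]] /=; apply/negP => /eqP xt.
    by apply: tr; exists B; rewrite -xt.
  have [B [fB tB tinB]] := tr.
  have hB := hlamB fB tB; have vB := hv fB tB.
  have [M [mM M0 subM]] := ae_generic (measurable_g hn hk (gam := gam))
    (mixture_invariant hn hk hlam vB hB) (mixture_ergodic hn hk hlam fB tB vB hB).
  apply: (@negligibleS _ Xmeas _ (lam t) ([set x : X | J x != t] `|` M)).
    move=> x [B' [fB' tB' xB' ng]] /=; have [xt|xt] := eqVneq (J x) t; [right|by left].
    by apply: subM; rewrite (fbasic_eq fB fB' (s := t)) // -xt.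
  apply: negligibleU => //; apply: lamr0_negligible => //.
  (* [lamB B] is a mixture in which [lam t] has the positive weight [v B t], so its null sets are
     null for [lam t]. *)
  move: M0; rewrite -[X in X = _]/(lamB B M) (mixtureE vB hB) // => -[] /eqP.
  have [v0 _ _ vpos] := vB; rewrite psumr_eq0 => [/allP/(_ t (mem_index_enum t))|u _]; last first.
    by rewrite mulr_ge0 // lamr_ge0.
  by rewrite /= mulf_eq0 gt_eqF ?vpos //= => /eqP.
have Nq q t : (lam t).-negligible (iter q g @^-1` N : set Xmeas).
  elim: q t => [|q IH] t; first exact: N0.
  rewrite (_ : _ @^-1` N = g @^-1` (iter q g @^-1` N)); first exact: lam_negligible_preimage.
  by apply/seteqP; split=> x; rewrite /preimage /= -iterS iterSr.
pose T := \bigcap_q [set x : X | J (iter q g x) \notin recurrent (gam := gam)].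
have mT : measurable (T : set Xmeas).
  apply: bigcapT_measurable => q.
  exact: (cylinder_J hn hk (fun s => s \notin recurrent (gam := gam)) q).
apply: (@negligibleS _ Xmeas _ (lam s) (T `|` \bigcup_q (iter q g @^-1` N))); last first.
  apply: negligibleU; last by apply: negligible_bigcup => q; exact: Nq.
  by apply: lamr0_negligible (mT) _; exact: (lamr_transient hn hk hlam).
move=> x xt; have [Tx|nTx] := pselect (T x); [by left|right].
apply: contrapT => xN; apply: nTx => q _ /=; apply/negP; rewrite finset.inE => /asboolP[B [fB tB xB]].
apply: xN; exists q => //; exists B; split=> // gB.
by apply: xt; exists B; split=> //; exact: generic_iter gB.
Qed.

End TypicalPoints.

(** * Ergodic measures of the terminal classes and tractability *)

Unset Implicit Arguments.

Theorem theorem5p5 (R : realType) (A : finType) (a0 : A) (n k : nat)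
  (hn : (0 < n)%N) (hk : (0 < k)%N)
  (gam : word A (n + k) -> word A n)
  (* the probability measures lambda_s, s in K = A^[n] *)
  (lam : word A n -> probability (Xm a0) R)
  (hlam : forall (s : word A n) (p : nat) (sb : 'I_p -> word A k),
      lam s (cyl_ext a0 s sb) = ((#|A|%:R : R) ^- (p * k))%:E)
  (* the stationary distributions v_B of Gamma, B terminal basic set of G *)
  (v : {set word A n} -> word A n -> R)
  (hv : forall B, fbasic (Grel gam) B -> fterminal (Grel gam) B ->
      stat_dist (Gam gam) B (v B))
  (* lambda_B = sum_{s in B} v_B(s) lambda_s *)
  (lamB : {set word A n} -> probability (Xm a0) R)
  (hlamB : forall B, fbasic (Grel gam) B -> fterminal (Grel gam) B ->
      forall S : set (Xm a0), lamB B S = (\sum_(s in B) (v B s)%:E * lam s S)%E) :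
  let g : @seqsp A a0 -> @seqsp A a0 := gmap a0 gam in
  (* the background measure lambda_0 = sum_s N^{-n} lambda_s *)
  let lam0 : set (Xm a0) -> \bar R :=
    fun S => (\sum_(s : word A n) ((#|A|%:R : R) ^- n)%:E * lam s S)%E in
  (* lambda_0 is the 1/N Bernoulli measure *)
  (forall (m : nat) (w : word A m), lam0 (cyl a0 w) = ((#|A|%:R : R) ^- m)%:E) /\
  (* each lambda_B is ergodic, g-invariant, with support H_gamma(B*_{G*}) *)
  (forall B, fbasic (Grel gam) B -> fterminal (Grel gam) B ->
     [/\ g_invariant g (lamB B), g_ergodic g (lamB B) &
         msupport (lamB B) = Hgam a0 (n:=n) (k:=k) @` BstarG gam B]) /\
  (* tractability of (X, g) w.r.t. lambda_0, with the measures lambda_B: *)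
  (* TRAC 1 *)
  finite_set [set C | gbasic g C] /\
  (* TRAC 2 *)
  (exists Nul : set (Xm a0), [/\ measurable Nul, lam0 Nul = 0%E &
     forall x, ~ Nul x -> exists B, [/\ fbasic (Grel gam) B,
        fterminal (Grel gam) B & generic g (lamB B) x]]) /\
  (* TRAC 3 *)
  (forall B, fbasic (Grel gam) B -> fterminal (Grel gam) B ->
     exists C, [/\ gbasic g C, visible g C & msupport (lamB B) `<=` C]) /\
  (* TRAC 4 *)
  (forall B B', fbasic (Grel gam) B -> fterminal (Grel gam) B ->
     fbasic (Grel gam) B' -> fterminal (Grel gam) B' -> B != B' ->
     lam0 (msupport (lamB B) `&` msupport (lamB B')) = 0%E).
Proof.
move=> g lam0; split=> [m w|].
  have mC := measurable_cylat m (wext w : @seqsp A a0).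
  rewrite -(bernoulli_cylat hn hk hlam m (wext w)) /lam0 -sumEFin.
  apply: eq_bigr => s _; rewrite EFinM -lamrE //; congr (_ * lam s _)%E.
  by rewrite cylE cylatE.
have supp B (fB : fbasic (Grel gam) B) (tB : fterminal (Grel gam) B) :
    msupport (lamB B) = [set x | Defs.prefix n x \in B].
  exact: (mixture_support (mu := lamB B) hn hk hlam (hv B fB tB) (hlamB B fB tB)).
split=> [B fB tB|]; first split.
- exact: (mixture_invariant (mu := lamB B) hn hk hlam (hv B fB tB) (hlamB B fB tB)).
- exact: (mixture_ergodic (mu := lamB B) hn hk hlam fB tB (hv B fB tB) (hlamB B fB tB)).
- by rewrite supp // Hgam_image.
split; first exact: finite_gbasic.
split.
  have /choice[M MP] := ae_typical hn hk hlam hv hlamB.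
  pose N : set (Xm a0) := \bigcap_(s in [set: word A n]) M s.
  have mN : measurable N.
    by apply: fin_bigcap_measurable => [|s _]; [exact: finite_finset|have [] := MP s].
  exists N; split=> //.
    rewrite /lam0 big1 // => s _; have [mM M0 _] := MP s.
    suff -> : lam s N = 0%E by rewrite mule0.
    apply/eqP; rewrite eq_le measure_ge0 andbT -[leRHS]M0.
    by apply: le_measure; rewrite ?inE // => x; apply.
  move=> x xN; apply: contrapT => xt; apply: xN => s _.
  by have [_ _] := MP s; apply.
split=> [B fB tB|B B' fB tB fB' tB' BB'].
  by rewrite supp //; exact: fbasic_visible.
(* Distinct basic sets are disjoint, hence so are the unions of cylinders over them. *)
rewrite !supp // (_ : _ `&` _ = set0) /lam0.
  by apply: big1 => s _; rewrite measure0 mule0.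
apply/seteqP; split=> // x [/= xB xB']; move/eqP: BB'; apply.
exact: fbasic_eq fB fB' xB xB'.
Qed.
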